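(* With probability one: (1) for every point $\xi\in K$, $\mu^{\bullet}(\xi)\geq 2$; and (2) for every real number $\mu\geq 2$, $\dim_H(\mathcal{M}^{\bullet}(\mu)\cap K)=\max\left\{\frac{2}{\mu}+\kappa-1,\frac{\kappa}{\mu}\right\}$.
   Context: $\mathbb{T}=\mathbb{R}/\mathbb{Z}$ with quotient distance $d$. $K$ is the image in $\mathbb{T}$ of the middle-third Cantor set, $\kappa=\log2/\log3$. Let $\mathcal{P}$ be the set of integer pairs $(p,q)$ with $0\le p<q$ and $\gcd(p,q)=1$; for $j\ge1$ let $\mathcal{P}^j=\{(p,q)\in\mathcal{P}: 3^j\le q<3^{j+1}\}$, and for $\mathcal{P}'\subseteq\mathcal{P}$ let $\sigma(\mathcal{P}')=\limsup_{j\to\infty}\frac1j\log_3\#(\mathcal{P}'\cap\mathcal{P}^j)$. Fix a subset $\mathcal{P}_K\subseteq\mathcal{P}$ with $\sigma(\mathcal{P}_K)=\kappa$. Let $(Y_{p,q})_{(p,q)\in\mathcal{P}}$ be independent random points of $\mathbb{T}$ such that $Y_{p,q}$ is distributed according to the normalized $\kappa$-dimensional Hausdorff measure restricted to $K$ if $(p,q)\in\mathcal{P}_K$, and according to Lebesgue measure on $\mathbb{T}$ otherwise. For $\mu\ge0$ let $\mathcal{F}(\mu)=\{\xi\in\mathbb{T}: d(\xi,Y_{p,q})<q^{-\mu}\text{ for infinitely many }(p,q)\in\mathcal{P}\}$, let $\mu^{\bullet}(\xi)=\sup\{\mu\ge0:\xi\in\mathcal{F}(\mu)\}$, and $\mathcal{M}^{\bullet}(\mu)=\{\xi\in\mathbb{T}:\mu^{\bullet}(\xi)\ge\mu\}$.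 $\dim_H$ is Hausdorff dimension. *)

(* Defs.v *)
From HB Require Import structures.
From mathcomp Require Import all_boot all_order all_algebra.
From mathcomp Require Import all_classical all_reals all_analysis.
Set Implicit Arguments. Unset Strict Implicit. Unset Printing Implicit Defensive.
Import Order.TTheory GRing.Theory Num.Theory.
Import numFieldNormedType.Exports.
Local Open Scope classical_set_scope.
Local Open Scope ring_scope.

Section Defs.
Variable R : realType.

(** The torus T = R/Z is represented by the set of representatives [0,1[. *)
Definition Trep : set R := `[0, 1[%classic.

Definition frac (z : R) : R := z - (Num.floor z)%:~R.

Definition dT (x y : R) : R := Num.min (frac (x - y)) (1 - frac (x - y)).

Definition cantor_set : set R :=
  [set x | exists a : nat -> bool,
     x = limn (fun N => \sum_(0 <= n < N)
                 ((if a n then 2 else 0) / 3 ^+ n.+1 : R))].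

(** image of the Cantor set in T (1 is identified with 0, which is in C) *)
Definition K : set R := cantor_set `&` Trep.

Definition kappa : R := ln 2 / ln 3.

Definition diamT (U : set R) : \bar R :=
  ereal_sup [set (dT x y)%:E | x in U & y in U].

Definition hausdorff_delta (s delta : R) (A : set R) : \bar R :=
  ereal_inf [set (\sum_(0 <= i <oo) ((fine (diamT (U i))) `^ s)%:E)%E |
     U in [set U : nat -> set R |
       (forall i, U i `<=` Trep) /\ A `<=` \bigcup_i U i /\
       (forall i, (diamT (U i) <= delta%:E)%E)]].

Definition hausdorff (s : R) (A : set R) : \bar R :=
  ereal_sup [set hausdorff_delta s delta A | delta in [set d : R | 0 < d]].

Definition hdim (A : set R) : \bar R :=
  ereal_inf [set s%:E | s in [set s : R | 0 < s /\ hausdorff s A = 0%E]].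

Definition Pcal : set (nat * nat) :=
  [set pq | (pq.1 < pq.2)%N /\ coprime pq.1 pq.2].

Definition countPj (P' : set (nat * nat)) (j : nat) : nat :=
  (\sum_(q < 3 ^ j.+1) \sum_(p < q)
      `[< P' (nat_of_ord p, nat_of_ord q) /\ Pcal (nat_of_ord p, nat_of_ord q)
          /\ (3 ^ j <= q)%N >])%N.

Definition sigmaP (P' : set (nat * nat)) : \bar R :=
  limn_esup (fun j : nat =>
    if countPj P' j == 0%N then -oo%E
    else (ln (countPj P' j)%:R / (j%:R * ln 3))%:E).

(** F(mu) for a realization y of the random points *)
Definition Fset (y : nat * nat -> R) (mu : R) : set R :=
  [set xi | Trep xi /\
     infinite_set [set pq | Pcal pq /\ dT xi (y pq) < (pq.2%:R) `^ (- mu)]].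

Definition mubullet (y : nat * nat -> R) (xi : R) : \bar R :=
  ereal_sup [set mu%:E | mu in [set mu : R | 0 <= mu /\ Fset y mu xi]].

Definition Mbullet (y : nat * nat -> R) (mu : R) : set R :=
  [set xi | Trep xi /\ (mu%:E <= mubullet y xi)%E].

End Defs.

(* Main.v *)
(** Points of the Cantor set are sequences of binary digits, so a cylinder of
    level [m] has diameter [3^-m] and mass [2^-m = 3^-(kappa m)]; the mass is forced
    by the translation invariance of the Hausdorff measure, which makes all the
    cylinders of a level equiprobable.

    Upper bound: a ball of radius [r] around a Lebesgue point meets K with
    probability at most a constant times [r^(1 - kappa)], so the expected cost of
    the natural cover of F(mu) by the balls is a geometric series as soon as
    [s > max (2/mu + kappa - 1, kappa/mu)].

    Lower bound and [mubullet >= 2]: at infinitely many scales [j], almost surely,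
    every word of length [n] has an extension of length [m ~ j mu] whose cylinder
    contains one of the points with [3^j <= q < 3^(j+1)], provided the expected
    number of such points below a given word is large compared with [n].  This allows
    [n ~ m s / kappa] for every [s < kappa/mu] (points of P_K) and every
    [s < 2/mu + kappa - 1] (Lebesgue points, of which there are about [9^j] by
    Gauss's identity for the totient); with [mu < 2] it even allows [n = m].
    Choosing very sparse scales, the digits in the windows [[n, m[] are prescribed
    and the others are free, and a mass distribution argument bounds the dimension
    from below.  Rational values of [mu] and [s] suffice by monotonicity. *)

Require Import Defs.
From HB Require Import structures.
From mathcomp Require Import all_boot all_order all_algebra.
From mathcomp Require Import all_classical all_reals all_analysis.
From mathcomp Require Import measurable_realfun cyclic ring lra zify.
Set Implicit Arguments. Unset Strict Implicit. Unset Printing Implicit Defensive.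
Import Order.TTheory GRing.Theory Num.Theory.
Import numFieldNormedType.Exports.
Local Open Scope classical_set_scope.
Local Open Scope ring_scope.

(** * Cylinders of the Cantor set *)

Section CantorGeometry.
Context {R : realType}.
Implicit Types (a b : nat -> bool) (u v : seq bool) (x y z : R).

Definition cpart a (N : nat) : R :=
  \sum_(0 <= n < N) ((if a n then 2 else 0) / 3 ^+ n.+1).

Definition cantor_pt a : R := limn (cpart a).

Definition wval v : R := cpart (nth false v) (size v).

(* Half-open, hence contained in [Trep]; a Cantor point whose tail is constantly
   [true] is the missing right end of its cylinder, see [prefix_cyl]. *)
Definition cyl v : set R := `[wval v, wval v + 3 ^- size v[%classic.

Lemma inv3S n : 3 ^- n.+1 = 3 ^- n / 3 :> R.
Proof. by rewrite exprS invfM mulrC. Qed.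

Lemma inv3_gt0 n : 0 < 3 ^- n :> R.
Proof. by rewrite invr_gt0 exprn_gt0. Qed.

Lemma cpartS a N : cpart a N.+1 = cpart a N + (a N)%:R * 2 * 3 ^- N / 3.
Proof.
rewrite /cpart big_nat_recr //= exprS invfM.
by case: (a N); [rewrite mul1r; ring | rewrite !mul0r].
Qed.

Lemma cpart0 a : cpart a 0 = 0.
Proof. by rewrite /cpart big_geq. Qed.

Lemma eq_cpart a b N : (forall i, (i < N)%N -> a i = b i) -> cpart a N = cpart b N.
Proof.
by move=> ab; apply: eq_big_nat => i /andP[_ iN]; rewrite ab.
Qed.

(** The digits from [N] on contribute at most the geometric sum of the [2 / 3 ^+ n.+1], which
    telescopes to [3 ^- N - 3 ^- (N + k)]. *)
Lemma cpart_bound a N k :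
  cpart a N <= cpart a (N + k) <= cpart a N + 3 ^- N - 3 ^- (N + k).
Proof.
elim: k => [|k]; first by rewrite addn0 addrK lexx.
rewrite addnS cpartS inv3S; have := inv3_gt0 (N + k).
set t := 3 ^- (N + k); case: (a _) => /=; lra.
Qed.

Lemma cpart_ge0 a N : 0 <= cpart a N.
Proof. by have /andP[] := cpart_bound a 0 N; rewrite cpart0. Qed.

Lemma cpart_le1 a N : cpart a N <= 1 - 3 ^- N.
Proof. by have /andP[_] := cpart_bound a 0 N; rewrite cpart0 expr0 invr1 add0r. Qed.

Lemma nondecreasing_cpart a : nondecreasing_seq (cpart a).
Proof.
move=> m n mn; rewrite -(subnKC mn).
by have /andP[] := cpart_bound a m (n - m).
Qed.

Lemma cvg_cpart a : cvgn (cpart a).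
Proof.
apply: nondecreasing_is_cvgn; first exact: nondecreasing_cpart.
exists 1 => _ [n _ <-]; apply: le_trans (cpart_le1 a n) _.
by have := inv3_gt0 n; lra.
Qed.

Lemma cantor_pt_bound a N : cpart a N <= cantor_pt a <= cpart a N + 3 ^- N.
Proof.
rewrite nondecreasing_cvgn_le/=; last exact: cvg_cpart.
  apply: limr_le; first exact: cvg_cpart.
  near=> n; have nN : (N <= n)%N by near: n; exact: nbhs_infty_ge.
  have := cpart_bound a N (n - N); rewrite subnKC //.
  by have := inv3_gt0 n; lra.
exact: nondecreasing_cpart.
Unshelve. all: by end_near. Qed.

(** Partial sums of length [l] are multiples of [2 * 3 ^- l], so closeness below that step forces
    equality. In the induction, dropping the last digit changes the difference by at most
    [2 / 3 * 3 ^- l], which stays within the wider step of the shorter length. *)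
Lemma cpart_sep a b l : `|cpart a l - cpart b l| < 2 * 3 ^- l ->
  forall i, (i < l)%N -> a i = b i.
Proof.
elim: l => [//|l IH]; rewrite !cpartS inv3S => H.
have t0 := inv3_gt0 l; move: H; set t := 3 ^- l in t0 * => H.
have ab i : (i < l)%N -> a i = b i.
  apply: IH; rewrite -/t; move: H; rewrite !ltr_norml.
  by case: (a l); case: (b l) => /=; lra.
move=> i; rewrite ltnS leq_eqVlt => /predU1P[->|/ab//].
move: H; rewrite (eq_cpart ab) ltr_norml.
by case: (a l); case: (b l) => //=; lra.
Qed.

(** Each point exceeds its partial sum by at most [3 ^- l], so the two partial sums are closer than
    [2 * 3 ^- l]. *)
Lemma cantor_pt_sep a b l : `|cantor_pt a - cantor_pt b| < 3 ^- l ->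
  forall i, (i < l)%N -> a i = b i.
Proof.
move=> H; apply: cpart_sep; move: H; rewrite !ltr_norml.
have := cantor_pt_bound a l; have := cantor_pt_bound b l; lra.
Qed.

Lemma cantor_pt_ge0 a : 0 <= cantor_pt a.
Proof. by have := cantor_pt_bound a 0; rewrite cpart0; lra. Qed.

Lemma mkseq_eqP a v :
  (forall i, (i < size v)%N -> a i = nth false v i) <-> mkseq a (size v) = v.
Proof.
split=> [H|<- i]; last by rewrite size_mkseq => ?; rewrite nth_mkseq.
apply: (@eq_from_nth _ false); rewrite size_mkseq // => i iv.
by rewrite nth_mkseq ?H.
Qed.

Lemma cpart_prefix a v : mkseq a (size v) = v -> cpart a (size v) = wval v.
Proof. by move/mkseq_eqP/eq_cpart. Qed.

Lemma cyl_cantor_pt a v : cyl v (cantor_pt a) -> mkseq a (size v) = v.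
Proof.
rewrite /cyl /= in_itv /= => H; apply/mkseq_eqP; apply: cpart_sep.
rewrite -/(wval v) ltr_norml; have := cantor_pt_bound a (size v).
have := inv3_gt0 (size v); lra.
Qed.

Lemma prefix_cyl a v : mkseq a (size v) = v ->
  cyl v (cantor_pt a) \/ cantor_pt a = wval v + 3 ^- size v.
Proof.
move=> av; rewrite /cyl /= in_itv /= -(cpart_prefix av).
have /andP[-> aN] /= := cantor_pt_bound a (size v).
by rewrite lt_neqAle aN andbT; case: eqVneq => E; [right|left].
Qed.

Lemma cyl_inj u v y : size u = size v -> cyl u y -> cyl v y -> u = v.
Proof.
rewrite /cyl /= !in_itv /= => uv; rewrite uv => Hu Hv.
have E : mkseq (nth false u) (size v) = v.
  apply/mkseq_eqP; apply: cpart_sep.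
  have -> : cpart (nth false u) (size v) = wval u by rewrite /wval uv.
  rewrite -/(wval v) ltr_norml; have := inv3_gt0 (size v); lra.
by rewrite -{1}E -uv; apply/esym/mkseq_eqP.
Qed.

Lemma measurable_cyl v : measurable (cyl v).
Proof. exact: measurable_itv. Qed.

Lemma cyl_Trep v : cyl v `<=` @Trep R.
Proof.
move=> y; rewrite /cyl /Trep /= !in_itv /=.
have := cpart_ge0 (nth false v) (size v); have := cpart_le1 (nth false v) (size v).
rewrite -/(wval v); lra.
Qed.

End CantorGeometry.

(** * Hausdorff measure on the torus *)

Lemma nneseries_ge_term {R : realType} (f : nat -> \bar R) i :
  (forall k, (0 <= f k)%E) -> (f i <= \sum_(0 <= k <oo) f k)%E.
Proof.
move=> f0; rewrite (nneseries_split 0 i.+1); last by move=> k _; exact: f0.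
rewrite big_nat_recr //= -addeA addeC -addeA leeDl //.
by apply: adde_ge0; [apply: nneseries_ge0 => k _ _|apply: sume_ge0 => k _].
Qed.

Lemma inv3_small {R : realType} (e : R) : 0 < e -> exists n, 3 ^- n < e.
Proof.
move=> e0; exists (Num.truncn e^-1).+1.
rewrite -[ltRHS]invrK ltf_pV2 ?posrE ?invr_gt0 ?exprn_gt0 //.
apply: lt_le_trans (truncnS_gt _) _; rewrite -natrX ler_nat.
by apply: ltnW; apply: ltn_expl.
Qed.

Section TorusDistance.
Context {R : realType}.
Implicit Types (x y z t : R) (U : set R).

Lemma frac_itv x : 0 <= Defs.frac x < 1.
Proof.
rewrite /Defs.frac; have := real_floor_itv (num_real x); by rewrite intrD; lra.
Qed.

(** Together with [dT_int], this makes [dT x y] the minimum of [|x - y - k|] over the integers [k];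
    symmetry and the triangle inequality are deduced from that form. *)
Lemma dT_le_int x y (k : int) : dT x y <= `|x - y - k%:~R|.
Proof.
have := frac_itv (x - y); rewrite /dT /Defs.frac; set z := x - y; set f := Num.floor z.
move=> fz; rewrite ge_min; have [kf|fk] := leP k f; apply/orP; [left|right].
  have : (k%:~R : R) <= f%:~R by rewrite ler_int.
  by move=> ?; rewrite ger0_norm; lra.
have : ((f + 1)%:~R : R) <= k%:~R by rewrite ler_int lezD1.
by rewrite intrD => ?; rewrite ler0_norm; lra.
Qed.

Lemma dT_int x y : exists k : int, dT x y = `|x - y - k%:~R|.
Proof.
have := frac_itv (x - y); rewrite /dT /Defs.frac; set z := x - y; set f := Num.floor z.
move=> fz; rewrite minEle; case: ifP => _.
  by exists f; rewrite ger0_norm; lra.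
by exists (f + 1); rewrite intrD ler0_norm; lra.
Qed.

Lemma dT_ge0 x y : 0 <= dT x y.
Proof. by have [k ->] := dT_int x y. Qed.

Lemma dT_le_half x y : dT x y <= 1 / 2.
Proof.
rewrite /dT ge_min; case: (leP (Defs.frac (x - y)) (1 / 2)) => //= ?.
by have := frac_itv (x - y); lra.
Qed.

Lemma dT_le_norm x y : dT x y <= `|x - y|.
Proof. by have := dT_le_int x y 0; rewrite subr0. Qed.

Lemma dTC x y : dT x y = dT y x.
Proof.
suff H (u v : R) : dT u v <= dT v u by apply/eqP; rewrite eq_le !H.
have [k ->] := dT_int v u; apply: le_trans (dT_le_int u v (- k)) _.
by rewrite -normrN intrN; rewrite le_eqVlt; apply/orP; left; apply/eqP; congr `|_|; lra.
Qed.

Lemma dT_triangle z x y : dT x y <= dT x z + dT z y.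
Proof.
have [k ->] := dT_int x z; have [l ->] := dT_int z y.
apply: le_trans (dT_le_int x y (k + l)) _.
apply: le_trans (ler_normD _ _); rewrite intrD.
by rewrite le_eqVlt; apply/orP; left; apply/eqP; congr `|_|; lra.
Qed.

Lemma dT_norm x y : `|x - y| <= 1 / 2 -> dT x y = `|x - y|.
Proof.
move=> H; apply/eqP; rewrite eq_le dT_le_norm /=.
have [k ->] := dT_int x y; have [->|k0] := eqVneq k 0; first by rewrite subr0.
have k1 : 1 <= `|k%:~R : R| by rewrite -intr_norm -[1]/(1%:~R) ler_int; lia.
by have := lerB_dist (k%:~R) (x - y); rewrite distrC; lra.
Qed.

(** The supremum [diamT] of the empty set is [-oo], which [fine] sends to 0: for a positive
    exponent, empty sets cost nothing in a cover. *)
Definition diam U : R := fine (diamT U).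

Lemma diamT_le_half U : (diamT U <= (1 / 2)%:E)%E.
Proof.
by apply: ge_ereal_sup => _ [x _ [y _ <-]]; rewrite lee_fin dT_le_half.
Qed.

Lemma diamT_ubound U x y : U x -> U y -> ((dT x y)%:E <= diamT U)%E.
Proof. by move=> Ux Uy; apply: ereal_sup_ubound; exists x => //; exists y. Qed.

Lemma diamT_fin_num U x : U x -> diamT U \is a fin_num.
Proof.
move=> Ux; rewrite fin_numE; apply/andP; split.
  apply/eqP => E; have := diamT_ubound Ux Ux; rewrite E leeNy_eq.
  by [].
by apply/eqP => E; have := diamT_le_half U; rewrite E.
Qed.

Lemma diam_set0 U : U `<=` set0 -> diam U = 0.
Proof.
move=> U0; rewrite /diam (_ : diamT U = -oo%E) //.
rewrite /diamT (_ : [set _ | _ in U & _ in U] = set0) ?ereal_sup0 //.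
by rewrite -subset0 => r [x /U0].
Qed.

Lemma diam_ge0 U : 0 <= diam U.
Proof.
have [->|/set0P[x Ux]] := eqVneq U set0; first by rewrite diam_set0.
rewrite /diam fine_ge0 //; apply: le_trans (diamT_ubound Ux Ux).
by rewrite lee_fin dT_ge0.
Qed.

Lemma diamT_le U (r : R) : (diamT U <= r%:E)%E <-> forall x y, U x -> U y -> dT x y <= r.
Proof.
split=> [H x y Ux Uy|H]; first by rewrite -lee_fin (le_trans _ H)// diamT_ubound.
by apply: ge_ereal_sup => _ [x Ux [y Uy <-]]; rewrite lee_fin H.
Qed.

Lemma diam_le U (r : R) : 0 <= r -> (forall x y, U x -> U y -> dT x y <= r) -> diam U <= r.
Proof.
move=> r0 /diamT_le H; have [->|/set0P[x Ux]] := eqVneq U set0; first by rewrite diam_set0.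
by rewrite -lee_fin fineK // (diamT_fin_num Ux).
Qed.

Lemma dT_le_diam U x y : U x -> U y -> dT x y <= diam U.
Proof.
by move=> Ux Uy; rewrite -lee_fin fineK ?(diamT_fin_num Ux) // diamT_ubound.
Qed.

Lemma diam_diamT_le U (r : R) : diam U <= r -> (diamT U <= r%:E)%E.
Proof. by move=> H; apply/diamT_le => x y Ux Uy; apply: le_trans H; exact: dT_le_diam. Qed.

Lemma diam_le_half U : diam U <= 1 / 2.
Proof. by apply: diam_le => // x y _ _; exact: dT_le_half. Qed.

End TorusDistance.

Section Hausdorff.
Context {R : realType}.
Implicit Types (s : R) (A B : set R) (U : nat -> set R).

Definition cover_sum s U : \bar R := (\sum_(0 <= i <oo) ((diam (U i)) `^ s)%:E)%E.

Lemma cover_sum_ge0 s U : (0 <= cover_sum s U)%E.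
Proof. by apply: nneseries_ge0 => i _ _; rewrite lee_fin powR_ge0. Qed.

Lemma hausdorff_ge0 s A : (0 <= hausdorff s A)%E.
Proof.
apply: (@le_trans _ _ (hausdorff_delta s 1 A)).
  by apply: le_ereal_inf_tmp => _ [U _ <-]; exact: cover_sum_ge0.
by apply: ereal_sup_ubound; exists 1; rewrite /=.
Qed.

(** The mesh condition comes for free: every term is at most the whole sum, so a sum below
    [delta ^ s] forces all diameters below [delta]. *)
Lemma hausdorff_null s A : 0 < s ->
  (forall eta : R, 0 < eta -> exists U, [/\ forall i, U i `<=` @Trep R,
     A `<=` \bigcup_i U i & (cover_sum s U <= eta%:E)%E]) ->
  hausdorff s A = 0%E.
Proof.
move=> s0 H; apply/eqP; rewrite eq_le hausdorff_ge0 andbT.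
apply: ge_ereal_sup => _ [delta /= d0 <-]; apply/lee_addgt0Pr => eta e0.
rewrite add0e; pose eta' := Num.min eta (delta `^ s).
have e'0 : 0 < eta' by rewrite lt_min e0 powR_gt0.
have [U [UT AU Us]] := H _ e'0; apply: (@le_trans _ _ (cover_sum s U)).
  apply: ereal_inf_lbound; exists U => //; do 2!split=> //; move=> i.
  apply: diam_diamT_le; rewrite leNgt; apply/negP => di.
  have : ((diam (U i) `^ s)%:E <= eta'%:E)%E.
    by apply: le_trans Us; apply: (@nneseries_ge_term _ (fun i => (diam (U i) `^ s)%:E)) => k;
      rewrite lee_fin powR_ge0.
  apply/negP; rewrite lee_fin -ltNge gt_min; apply/orP; right.
  by apply: gt0_ltr_powR; rewrite ?nnegrE ?diam_ge0 // ltW.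
apply: le_trans Us _; rewrite lee_fin /eta' ge_min.
by rewrite lexx.
Qed.

Lemma hausdorff_eq0_cover s A (eta : R) : hausdorff s A = 0%E -> 0 < eta ->
  exists U, [/\ forall i, U i `<=` @Trep R, A `<=` \bigcup_i U i & (cover_sum s U < eta%:E)%E].
Proof.
move=> H e0; have : (hausdorff_delta s 1 A < eta%:E)%E.
  apply: le_lt_trans (_ : hausdorff s A < _)%E; last by rewrite H lte_fin.
  by apply: ereal_sup_ubound; exists 1; rewrite /=.
by case/ereal_inf_lt => _ [U [UT [AU _]] <-] ?; exists U; split.
Qed.

(** [dT] depends only on the difference of its arguments, so a cover of [A] translated by [t] and
    cut down to [Trep] covers [B] at no greater cost. *)
Lemma hausdorff_translate_le s (t : R) A B : 0 <= s -> B `<=` @Trep R ->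
  (forall y, B y -> A (y - t)) -> (hausdorff s B <= hausdorff s A)%E.
Proof.
move=> s0 BT BA; apply: ge_ereal_sup => _ [delta d0 <-].
apply: (@le_trans _ _ (hausdorff_delta s delta A)); last first.
  by apply: ereal_sup_ubound; exists delta.
apply: le_ereal_inf_tmp => _ [U [UT [AU Ud]] <-].
pose V i := [set y | Trep y /\ U i (y - t)].
have dV i x y : V i x -> V i y -> dT x y <= diam (U i).
  move=> [_ Ux] [_ Uy]; have := dT_le_diam Ux Uy.
  by rewrite {1}/dT opprB addrA subrK.
apply: (@le_trans _ _ (cover_sum s V)).
  apply: ereal_inf_lbound; exists V => //; split; first by move=> i y [].
  split=> [y By|i].
    by have [i _ Ui] := AU _ (BA _ By); exists i => //; split => //; exact: BT.
  apply: diam_diamT_le; apply: diam_le => [|x y Vx Vy]; first exact: ltW.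
  by case: Vx Vy => ? Ux [? Uy]; have /diamT_le/(_ _ _ Ux Uy) := Ud i;
    rewrite /dT opprB addrA subrK.
apply: lee_nneseries => i _; first by rewrite lee_fin powR_ge0.
rewrite lee_fin; apply: ge0_ler_powR; rewrite ?nnegrE ?diam_ge0 //.
by apply: diam_le; [exact: diam_ge0|exact: dV].
Qed.

Lemma hausdorff_le s A B : 0 <= s -> A `<=` @Trep R -> A `<=` B ->
  (hausdorff s A <= hausdorff s B)%E.
Proof.
move=> s0 AT AB; apply: (@hausdorff_translate_le _ 0) => //; move=> y Ay.
by rewrite subr0; exact: AB.
Qed.

Lemma hausdorff_set1 s (x : R) : 0 < s -> Trep x -> hausdorff s [set x] = 0%E.
Proof.
move=> s0 Tx; apply: hausdorff_null => // eta e0; exists (fun=> [set x]); split.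
- by move=> _ _ ->.
- by move=> _ ->; exists 0%N.
- rewrite /cover_sum eseries0 ?lee_fin ?ltW // => i _ _.
  rewrite (_ : diam _ = 0) ?powR0 ?gt_eqF //.
  apply/eqP; rewrite eq_le diam_ge0 andbT; apply: diam_le => // _ _ -> ->.
  by have := dT_le_norm x x; rewrite subrr normr0.
Qed.

End Hausdorff.

(** * Mass distribution on a tree with prescribed digits *)

Section Tree.
Context {R : realType} (fr : nat -> bool) (fd : seq bool -> bool).
Implicit Types (a : nat -> bool) (u : seq bool).

(** [fr] marks the free positions; at the others [fd] computes the digit from the word of all
    preceding ones. *)
Definition admissible a := forall n, ~~ fr n -> a n = fd (mkseq a n).

Definition nfree n := count fr (iota 0 n).

Lemma nfreeS n : nfree n.+1 = (nfree n + fr n)%N.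
Proof. by rewrite /nfree -addn1 iotaD count_cat /= add0n addn0. Qed.

Lemma prefix_rcons u (d : bool) (v : seq bool) :
  prefix (rcons u d) v -> prefix u v /\ nth false v (size u) = d.
Proof.
move=> /prefixP[w ->]; split; first by rewrite -cats1 -catA prefix_prefix.
by rewrite nth_cat size_rcons ltnSn nth_rcons ltnn eqxx.
Qed.

Section Cover.
Variable v : nat -> seq bool.

(** An upper bound for the conditional mass of the cylinder [v i] inside that of [u], when the free
    digits are independent fair coins. *)
Let term u i : R :=
  if prefix u (v i) then 2 ^+ nfree (size u) / 2 ^+ nfree (size (v i)) else 0.

Let weight u : \bar R := (\sum_(0 <= i <oo) (term u i)%:E)%E.

Let term_ge0 u i : 0 <= term u i.
Proof. by rewrite /term; case: ifP => // _; rewrite divr_ge0 ?exprn_ge0. Qed.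

Let term_forced u d i : ~~ fr (size u) -> term (rcons u d) i <= term u i.
Proof.
move=> nf; rewrite {1}/term; case: ifP => [/prefix_rcons[uv _]|]; last by rewrite term_ge0.
by rewrite /term uv size_rcons nfreeS (negbTE nf) addn0.
Qed.

(** At most one child of [u] is a prefix of [v i], and passing to a child at most doubles the term.
    Hence the average weight of the two children is at most the weight of [u]. *)
Let term_free u i : term (rcons u false) i + term (rcons u true) i <= 2 * term u i.
Proof.
have H d : term (rcons u d) i <= if nth false (v i) (size u) == d then 2 * term u i else 0.
  rewrite {1}/term; case: ifP => [/prefix_rcons[uv /eqP->]|_].
    rewrite /term uv size_rcons nfreeS; set t := _ ^+ nfree (size (v i)).
    rewrite mulrA -exprS ler_pM2r ?invr_gt0 ?exprn_gt0 //.
    by apply: ler_weXn2l; rewrite ?ler1n // -addn1 leq_add2l leq_b1.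
  by case: ifP => // _; rewrite mulr_ge0.
have := H false; have := H true; case: (nth _ _ _) => /=; have := term_ge0 u i; lra.
Qed.

Let descend u := if fr (size u) then ~~ (weight (rcons u false) < 1)%E else fd u.

Let weight_descend u : (weight u < 1)%E -> (weight (rcons u (descend u)) < 1)%E.
Proof.
rewrite /descend; case: ifPn => [_|nf W1].
  case: (boolP (weight (rcons u false) < 1)%E) => //; rewrite -leNgt => W0 Wu.
  rewrite ltNge; apply/negP => W1; move: Wu; apply/negP; rewrite -leNgt.
  have : (weight (rcons u false) + weight (rcons u true) <= 2%:E * weight u)%E.
    rewrite /weight -nneseriesD => [|i _ _|i _ _]; rewrite ?lee_fin //.
    rewrite -nneseriesZl => [|i _]; rewrite ?lee_fin //.
    apply: lee_nneseries => i _; first by rewrite adde_ge0 ?lee_fin.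
    by rewrite -EFinD -EFinM lee_fin term_free.
  move=> H; have : (2%:E * 1 <= 2%:E * weight u)%E.
    by apply: le_trans H; rewrite mule1 -[2]/(1 + 1)%R EFinD leeD.
  by rewrite lee_pmul2l.
apply: le_lt_trans W1; apply: lee_nneseries => i _; rewrite lee_fin //.
exact: term_forced.
Qed.

Let walk := fix w n := if n is m.+1 then rcons (w m) (descend (w m)) else [::].

(* The total mass of a cover is the weight of the root; as long as it is
   below 1, one can walk down the tree keeping it below 1, so the walk meets
   no word of the cover. *)
Lemma tree_cover : (forall a, admissible a -> exists i, mkseq a (size (v i)) = v i) ->
  (1 <= \sum_(0 <= i <oo) ((2 ^+ nfree (size (v i)))^-1 : R)%:E)%E.
Proof.
move=> cov; rewrite leNgt; apply/negP => W1.
have szw n : size (walk n) = n by elim: n => //= n IH; rewrite size_rcons IH.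
have Ww n : (weight (walk n) < 1)%E.
  elim: n => [|n IH] /=; last exact: weight_descend.
  apply: le_lt_trans W1; apply: lee_nneseries => i _; rewrite lee_fin //.
  by rewrite /term prefix0s div1r.
pose a n := descend (walk n).
have aw n : mkseq a n = walk n.
  by elim: n => // n IH; rewrite mkseqS IH.
have [|i vi] := cov a.
  by move=> n nf; rewrite aw /a /descend szw (negbTE nf).
(* The walk passes through [v i], whose own term there is already 1. *)
have := Ww (size (v i)); rewrite -aw vi; apply/negP; rewrite -leNgt.
apply: le_trans (nneseries_ge_term i _) => [|k]; last by rewrite lee_fin.
by rewrite /term prefix_refl divff // expf_neq0.
Qed.

End Cover.

(* Forcing the first digit to be 0 keeps the points in [0, 1/3], where the torus
   distance is the absolute value of the difference. *)
Lemma tree_hausdorff (s C : R) : 0 < s -> 0 < C -> ~~ fr 0 -> fd [::] = false ->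
  (forall n, (2 ^+ nfree n)^-1 <= C * (3 ^- n) `^ s) ->
  hausdorff s [set (cantor_pt a : R) | a in admissible] <> 0%E.
Proof.
move=> s0 C0 fr0 fd0 Hfree H0.
(* The factor [3 ^ s] pays for replacing a diameter, known to be at least [3 ^- n.+1], by
   [3 ^- n]. *)
pose D := C * 3 `^ s; have D0 : 0 < D by rewrite mulr_gt0 ?powR_gt0.
(* Half of the total mass 1 is left for the errors [1 / 2 / 2 ^ i.+1], which handle the sets of
   diameter 0. *)
have [U [_ AU Us]] := hausdorff_eq0_cover H0 (divr_gt0 (divr_gt0 ltr01 (ltr0Sn _ 1)) D0).
have adm0 a : admissible a -> 0 <= cantor_pt a :> R /\ cantor_pt a <= 1 / 3 :> R.
  move=> /(_ 0%N fr0); rewrite fd0 => a0; split; first exact: cantor_pt_ge0.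
  by have := cantor_pt_bound (R := R) a 1; rewrite cpartS cpart0 a0 !mul0r !add0r expr1; lra.
have He i : 0 < 1 / 2 / (2 ^ i.+1)%:R :> R by rewrite !divr_gt0 // ltr0n expn_gt0.
have Hl i : exists l, diam (U i) < 3 ^- l /\
    (2 ^+ nfree l)^-1 <= D * diam (U i) `^ s + 1 / 2 / (2 ^ i.+1)%:R.
  have := diam_ge0 (U i); have := diam_le_half (U i); set r := diam (U i).
  move=> r1; rewrite le_eqVlt => /predU1P[<-|r0].
    have : 0 < (1 / 2 / (2 ^ i.+1)%:R / C) `^ s^-1 by rewrite powR_gt0 // divr_gt0.
    case/inv3_small => l Hl; exists l; rewrite inv3_gt0; split => //.
    rewrite powR0 ?gt_eqF // mulr0 add0r; apply: le_trans (Hfree l) _.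
    rewrite mulrC -ler_pdivlMr //; move: Hl; set X := _ / C => Hl.
    have X0 : 0 <= X by rewrite divr_ge0 ?ltW.
    have -> : X = (X `^ s^-1) `^ s by rewrite -powRrM mulVf ?lt0r_neq0 // powRr1.
    by apply: ge0_ler_powR; rewrite ?nnegrE ?ltW ?inv3_gt0 // (lt_trans (inv3_gt0 l)).
  (* The least such exponent is positive because [r <= 1 / 2]; its predecessor [n] satisfies
     [3 ^- n.+1 <= r < 3 ^- n]. *)
  have : exists n, 3 ^- n <= r by have [n /ltW] := inv3_small r0; exists n.
  case/ex_minnP => -[|n] rn nmin; first by move: rn; rewrite expr0 invr1; lra.
  exists n; have rlt : r < 3 ^- n.
    by rewrite ltNge; apply/negP => /nmin; rewrite ltnn.
  split => //; apply: le_trans (Hfree n) _.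
  rewrite -[leLHS]addr0; apply: lerD; last exact: ltW.
  rewrite /D -mulrA; apply: ler_wpM2l; first exact: ltW.
  rewrite -powRM //; last exact: ltW.
  apply: ge0_ler_powR; rewrite ?nnegrE; first exact: ltW.
  - exact: ltW (inv3_gt0 n).
  - by rewrite mulr_ge0 // ltW.
  - by move: rn; rewrite inv3S; lra.
have [l {}Hl] := choice Hl.
have Hv i : exists w, size w = l i /\
    forall a, admissible a -> U i (cantor_pt a) -> mkseq a (l i) = w.
  have [[b bA Ub]|nb] := pselect (exists2 b, admissible b & U i (cantor_pt b)).
    exists (mkseq b (l i)); rewrite size_mkseq; split => // a aA Ua.
    apply/eq_in_map => k; rewrite mem_iota add0n => kl.
    apply: (cantor_pt_sep (R := R)) kl.
    rewrite -dT_norm; last by have := adm0 _ aA; have := adm0 _ bA; rewrite ler_norml; lra.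
    by apply: le_lt_trans (dT_le_diam Ua Ub) _; have [] := Hl i.
  (* A set without admissible points receives an arbitrary word of the right length; its cost is
     bounded all the same. *)
  exists (nseq (l i) false); rewrite size_nseq; split => // a aA Ua.
  by case: nb; exists a.
have [w {}Hw] := choice Hv.
have /tree_cover : forall a, admissible a -> exists i, mkseq a (size (w i)) = w i.
  move=> a aA; have [|i _ Ui] := AU (cantor_pt a); first by exists a.
  by exists i; have [-> ->] := Hw i.
apply/negP; rewrite -ltNge.
apply: (@le_lt_trans _ _ (\sum_(0 <= i <oo)
    (D%:E * (diam (U i) `^ s)%:E + ((1 / 2) / (2 ^ i.+1)%:R)%:E))%E).
  apply: lee_nneseries => i _; first by rewrite lee_fin invr_ge0 exprn_ge0.
  by have [-> _] := Hw i; rewrite -EFinM -EFinD lee_fin; have [] := Hl i.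
apply: le_lt_trans (epsilon_trick _ _ _) _ => [n||].
- by rewrite -EFinM lee_fin mulr_ge0 ?powR_ge0 ?ltW.
- by [].
rewrite nneseriesZl => [|i _]; last by rewrite lee_fin powR_ge0.
have -> : 1%E = ((1 / 2)%:E + (1 / 2)%:E)%E :> \bar R by rewrite -EFinD; congr _%:E; lra.
rewrite lteD2rE //.
rewrite (_ : 1 / 2 = D * (1 / 2 / D)); last by rewrite [RHS]mulrC divfK ?lt0r_neq0.
by rewrite (EFinM D) lte_pmul2l.
Qed.

End Tree.

(** * Good scales and the tree they prescribe inside F(mu) *)

Lemma infinite_set_snd (A : set (nat * nat)) :
  (forall M, exists2 pq, A pq & (M <= pq.2)%N) -> infinite_set A.
Proof.
move=> H /finite_seqP[X AX].
have [pq] := H (\max_(x <- X) (x : nat * nat).2)%N.+1; rewrite AX /= => pX.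
by rewrite ltnNge (@leq_bigmax_seq _ X xpredT (fun x : nat * nat => x.2) _ pX).
Qed.

Lemma infinite_set_snd_ge (A : set (nat * nat)) M :
  A `<=` [set pq | (pq.1 < pq.2)%N] -> infinite_set A ->
  exists2 pq, A pq & (M <= pq.2)%N.
Proof.
move=> Alt Ainf; apply: contrapT => H; apply: Ainf.
apply: (@sub_finite_set _ _ (`I_M `*` `I_M)); last first.
  by apply: finite_setX; exact: finite_II.
move=> pq Apq; have q : (pq.2 < M)%N by rewrite ltnNge; apply/negP => ?; apply: H; exists pq.
by split => //=; apply: ltn_trans q; exact: Alt.
Qed.

Section Scales.
Context {R : realType}.
Local Notation kappa := (@kappa R).

Lemma ln3_gt0 : 0 < ln 3 :> R. Proof. by rewrite ln_gt0 // ltr1n. Qed.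
Lemma ln2_gt0 : 0 < ln 2 :> R. Proof. by rewrite ln_gt0 // ltr1n. Qed.

Lemma kappa_gt0 : 0 < kappa.
Proof. by rewrite /Defs.kappa divr_gt0 ?ln3_gt0 ?ln2_gt0. Qed.

Lemma kappa_lt1 : kappa < 1.
Proof. by rewrite /Defs.kappa ltr_pdivrMr ?ln3_gt0 // mul1r ltr_ln ?posrE // ltr_nat. Qed.

Lemma powR_kappa : 3 `^ kappa = 2 :> R.
Proof.
rewrite /powR pnatr_eq0 /=.
by rewrite /Defs.kappa divfK ?lnK ?posrE // gt_eqF // ln3_gt0.
Qed.

Lemma inv3E n : 3 ^- n = 3 `^ (- n%:R) :> R.
Proof. by rewrite powRN powR_mulrn. Qed.

Lemma inv2E n : 2 ^- n = 3 `^ (- (kappa * n%:R)) :> R.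
Proof. by rewrite powRN powRrM powR_kappa powR_mulrn. Qed.

Lemma powR3_gt0 (x : R) : 0 < 3 `^ x :> R. Proof. by rewrite powR_gt0. Qed.

Lemma ler_powR3 (x y : R) : (3 `^ x <= 3 `^ y :> R) = (x <= y).
Proof.
rewrite /powR pnatr_eq0 /=.
by rewrite ler_expR ler_pM2r // ln3_gt0.
Qed.

Lemma powR3D (x y : R) : 3 `^ (x + y) = 3 `^ x * 3 `^ y :> R.
Proof. by rewrite powRD // pnatr_eq0 implybT. Qed.

(* The scale [j] of the denominators, the length [n] of the words that are
   extended, and the length [m] of their extensions. *)
Definition good_scale (y : nat * nat -> R) (mu s : R) (j n m : nat)
    (e : seq bool -> seq bool) :=
  [/\ (n <= m)%N, s / kappa * m%:R - 1 < n%:R, j.+1%:R * mu <= m%:R &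
    forall u, size u = n -> [/\ size (e u) = m, take n (e u) = u &
      exists pq, [/\ Pcal pq, (3 ^ j <= pq.2 < 3 ^ j.+1)%N & cyl (e u) (y pq)]]].

(** Both points lie in the closed cylinder of [v], of length [3 ^- m <= 3 ^ (- (j.+1 * mu))]; the
    strict inequality comes from [q < 3 ^ j.+1]. *)
Lemma dT_cantor_pt_lt (y : nat * nat -> R) (mu : R) j m pq a v :
  0 < mu -> j.+1%:R * mu <= m%:R -> (0 < pq.2 < 3 ^ j.+1)%N ->
  size v = m -> mkseq a m = v -> cyl v (y pq) ->
  dT (cantor_pt a) (y pq) < pq.2%:R `^ (- mu).
Proof.
move=> mu0 jm /andP[q0 qj] sv av yv; apply: le_lt_trans (dT_le_norm _ _) _.
apply: (@le_lt_trans _ _ (3 ^- m)).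
  move: yv; rewrite -sv in av *; rewrite /cyl /= in_itv /= -(cpart_prefix av) ler_norml.
  by have := cantor_pt_bound (R := R) a (size v); lra.
apply: (@le_lt_trans _ _ ((3 ^ j.+1)%:R `^ (- mu))).
  rewrite natrX -powR_mulrn // -powRrM inv3E ler_powR3; lra.
rewrite !powRN ltf_pV2 ?posrE ?powR_gt0 ?ltr0n ?expn_gt0 //.
by apply: gt0_ltr_powR; rewrite ?nnegrE // ltr_nat.
Qed.

Section Construction.
Variables (y : nat * nat -> R) (mu s s' : R).
Hypotheses (mu0 : 0 < mu) (s'0 : 0 < s') (ss' : s' < s) (sk : s <= kappa).
Variable f : nat -> nat * nat * nat * (seq bool -> seq bool).
Let J x : nat := (x : nat * nat * nat * (seq bool -> seq bool)).1.1.1.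
Let N x : nat := (x : nat * nat * nat * (seq bool -> seq bool)).1.1.2.
Let L x : nat := (x : nat * nat * nat * (seq bool -> seq bool)).1.2.
Let E x := (x : nat * nat * nat * (seq bool -> seq bool)).2.
Hypothesis fP : forall M, (M <= J (f M))%N /\
  good_scale y mu s (J (f M)) (N (f M)) (L (f M)) (E (f M)).

Let gap : R := (s - s') / kappa.

Let gap_gt0 : 0 < gap.
Proof. by rewrite divr_gt0 ?kappa_gt0 // subr_gt0. Qed.

(** The term [J x] makes the scales strictly increasing; the quotient makes [gap] times the next
    extension length at least [2 + L x], as [N_ge] requires. *)
Let bound x := (J x + Num.truncn ((2 + (L x)%:R) / (gap * mu))).+1.

(* The dummy scale 0 only forces the first digit to be 0. *)
Let t := fix t k := if k is l.+1 then f (bound (t l)) else (0%N, 0%N, 1%N, fun=> [:: false]).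

Let t_good k : good_scale y mu s (J (t k.+1)) (N (t k.+1)) (L (t k.+1)) (E (t k.+1)).
Proof. by have [] := fP (bound (t k)). Qed.

Let J_lt k : (J (t k) < J (t k.+1))%N.
Proof. by have [+ _] := fP (bound (t k)); apply: leq_trans; rewrite ltnS leq_addr. Qed.

Let J_ge k : (k <= J (t k))%N.
Proof. by elim: k => // k IH; apply: leq_ltn_trans IH (J_lt k). Qed.

Let NL k : (N (t k) <= L (t k))%N.
Proof. by case: k => // k; have [] := t_good k. Qed.

(** Lowering [s] to [s'] gains [gap * L (t k.+1)], which pays for every position up to the end of
    the previous window and for the rounding in [good_scale]. *)
Let N_ge k : s' / kappa * (L (t k.+1))%:R + (L (t k))%:R + 1 <= (N (t k.+1))%:R :> R.
Proof.
have [_ /ltW + jm _] := t_good k; apply: le_trans.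
suff : 2 + (L (t k))%:R <= gap * (L (t k.+1))%:R.
  by rewrite /gap !mulrBl; lra.
have : ((bound (t k))%:R : R) <= (J (t k.+1)).+1%:R.
  by rewrite ler_nat; apply: leqW; have [] := fP (bound (t k)).
move=> H; apply: le_trans (_ : gap * ((bound (t k))%:R * mu) <= _); last first.
  by rewrite ler_pM2l //; apply: le_trans jm; rewrite ler_pM2r.
rewrite mulrCA -ler_pdivrMr ?(mulr_gt0 gap_gt0 mu0) //; apply: ltW.
apply: lt_le_trans (truncnS_gt _) _; rewrite ler_nat ltnS.
by rewrite leq_addl.
Qed.

Let LN k : (L (t k) < N (t k.+1))%N.
Proof.
rewrite -(ltr_nat R); have := N_ge k.
have : 0 <= s' / kappa * (L (t k.+1))%:R by rewrite mulr_ge0 // divr_ge0 ?ltW ?kappa_gt0.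
lra.
Qed.

Let LN_lt k l : (k < l)%N -> (L (t k) < N (t l))%N.
Proof.
elim: l => // l IH; rewrite ltnS leq_eqVlt => /predU1P[->|/IH H]; first exact: LN.
by apply: leq_trans H _; apply: leq_trans (NL _) (ltnW (LN _)).
Qed.

Let L_ge k : (k < L (t k))%N.
Proof. by elim: k => // k IH; apply: leq_ltn_trans IH _; apply: leq_trans (LN k) (NL _). Qed.

Let forced k l := (N (t k) <= l < L (t k))%N.

Let forced_inj k k' l : forced k l -> forced k' l -> k = k'.
Proof.
wlog kk : k k' / (k < k')%N => [W H H'|].
  by case: (ltngtP k k') => // kk; [exact: W|apply/esym; exact: W].
by move=> /andP[_ H] /andP[H' _]; have := LN_lt kk; lia.
Qed.

Let fr l := ~~ `[< exists k, forced k l >].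

(** The window containing the position [size u] is unique by [forced_inj], so the choice made by
    [cid] does not matter; the digit is read off the extension of the word preceding that window. *)
Let fd u := if pselect (exists k, forced k (size u)) is left H
  then nth false (E (t (proj1_sig (cid H))) (take (N (t (proj1_sig (cid H)))) u)) (size u)
  else false.

Let fdE k u : forced k (size u) ->
  fd u = nth false (E (t k) (take (N (t k)) u)) (size u).
Proof.
move=> ku; rewrite /fd; case: pselect => [H|[]]; last by exists k.
by case: cid => k' /= /forced_inj/(_ ku) ->.
Qed.

Let adm_ext a k : admissible fr fd a ->
  mkseq a (L (t k.+1)) = E (t k.+1) (mkseq a (N (t k.+1))).
Proof.
move=> aA; have [_ _ _ /(_ (mkseq a (N (t k.+1))))] := t_good k.
rewrite size_mkseq => /(_ erefl)[sE tE _].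
apply: (@eq_from_nth _ false); rewrite size_mkseq ?sE // => i iL.
rewrite nth_mkseq //; case: (ltnP i (N (t k.+1))) => iN.
  by rewrite -(nth_take _ iN) tE nth_mkseq.
have ki : forced k.+1 i by rewrite /forced iN.
rewrite aA; last by rewrite negbK; apply/asboolP; exists k.+1.
rewrite (@fdE k.+1) size_mkseq //; congr (nth _ (E _ _) _).
by rewrite -map_take take_iota (minn_idPl iN).
Qed.

Let nfree_mono l l' : (l <= l')%N -> (nfree fr l <= nfree fr l')%N.
Proof. by move=> /subnKC <-; rewrite /nfree iotaD count_cat leq_addr. Qed.

(** No window meets the stretch from the end of window [k] to the start of window [k.+1], so every
    position there is free. *)
Let nfree_gap k l : (L (t k) <= l <= N (t k.+1))%N ->
  nfree fr l = (nfree fr (L (t k)) + (l - L (t k)))%N.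
Proof.
move=> /andP[kl lk]; rewrite -{1}(subnKC kl) /nfree iotaD count_cat; congr addn.
rewrite add0n -[RHS](size_iota (L (t k))); apply/eqP; rewrite -all_count.
apply/allP => i; rewrite mem_iota => /andP[ki il]; apply/asboolPn => -[k' /andP[]].
case: (ltngtP k' k) => [/LN_lt|kk|->] ; first by have := NL k; lia.
- have : (N (t k.+1) <= N (t k'))%N.
    move: kk; rewrite leq_eqVlt => /predU1P[<-//|/LN_lt].
    by have := NL k.+1; lia.
  by lia.
- by lia.
Qed.

Let theta_ge0 : 0 <= s' / kappa.
Proof. by rewrite divr_ge0 ?ltW ?kappa_gt0. Qed.

Let theta_le1 : s' / kappa <= 1.
Proof. by rewrite ler_pdivrMr ?kappa_gt0 // mul1r; exact: ltW (lt_le_trans ss' sk). Qed.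

(** Between windows the count grows at rate 1, at least [s' / kappa]. Inside a window it stands
    still, but by [N_ge] the stretch before the window already supplies enough for its whole length.
    The [+ 1] accounts for the dummy window. *)
Let nfree_ge l : s' / kappa * l%:R <= (nfree fr l)%:R + 1.
Proof.
suff H k : (l <= L (t k))%N -> s' / kappa * l%:R <= (nfree fr l)%:R + 1 :> R.
  by apply: (H l); apply: ltnW; exact: L_ge.
elim: k l => [|k IH] l.
  move=> l1; apply: (@le_trans _ _ 1); last by rewrite lerDr.
  by rewrite mulr_ile1 // lern1.
case: (leqP l (L (t k))) => [/IH//|kl lk].
case: (leqP l (N (t k.+1))) => [lN|Nl].
  rewrite (@nfree_gap k) ?(ltnW kl) // natrD natrB 1?ltnW //.
  have := IH _ (leqnn _); have : ((L (t k))%:R : R) <= l%:R by rewrite ler_nat ltnW.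
  move=> H1 H2; have := ler_wpM2r (_ : 0 <= l%:R - (L (t k))%:R) theta_le1.
  rewrite subr_ge0 => /(_ H1); lra.
have : ((nfree fr (N (t k.+1)))%:R : R) <= (nfree fr l)%:R.
  by rewrite ler_nat; exact/nfree_mono/ltnW.
rewrite (@nfree_gap k) ?leqnn ?(ltnW (LN k)) // natrD natrB 1?ltnW //.
have := ler0n R (nfree fr (L (t k))).
have : s' / kappa * l%:R <= s' / kappa * (L (t k.+1))%:R by rewrite ler_wpM2l // ler_nat.
by have := N_ge k; lra.
Qed.

Lemma hausdorff_Fset_construction : hausdorff s' (Fset y mu `&` @K R) <> 0%E.
Proof.
move=> H0; have forced0 : forced 0 0 by [].
have fr0 : ~~ fr 0 by rewrite negbK; apply/asboolP; exists 0%N.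
have fd0 : fd [::] = false by rewrite (@fdE 0).
(* The constant 2, which is [3 ^ kappa], absorbs the [+ 1] of [nfree_ge]. *)
apply: (@tree_hausdorff R fr fd s' 2 s'0 _ fr0 fd0) => //.
  move=> n; rewrite inv2E inv3E -powRrM -[in leRHS]powR_kappa -powR3D ler_powR3.
  have := nfree_ge n; rewrite mulrAC ler_pdivrMr ?kappa_gt0 //.
  by lra.
have adm_Trep a : admissible fr fd a -> Trep (cantor_pt a : R).
  move=> aA; have a0 : a 0%N = false by rewrite aA.
  rewrite /Trep /= in_itv /= cantor_pt_ge0 /=.
  by have := cantor_pt_bound (R := R) a 1; rewrite cpartS cpart0 a0 !mul0r !add0r expr1; lra.
apply/eqP; rewrite eq_le hausdorff_ge0 andbT -H0.
apply: hausdorff_le => [|x [a aA <-]|x [a aA <-]]; first exact: ltW.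
  exact: adm_Trep.
split; last by split; [exists a|exact: adm_Trep].
split; first exact: adm_Trep.
apply: infinite_set_snd => M; have [_ _ jm] := t_good M.
move=> /(_ (mkseq a (N (t M.+1)))); rewrite size_mkseq => /(_ erefl).
rewrite -adm_ext // => -[sE _ [pq [Ppq /andP[q1 q2] yv]]]; exists pq; last first.
  apply: leq_trans q1; apply: leq_trans (J_ge M) _.
  by apply: leq_trans (ltnW (J_lt M)) _; apply/ltnW/ltn_expl.
split => //; apply: (dT_cantor_pt_lt mu0 jm _ sE erefl yv).
by rewrite q2 andbT (leq_trans _ q1) ?expn_gt0.
Qed.

End Construction.

Lemma hausdorff_Fset_neq0 (y : nat * nat -> R) (mu s s' : R) :
  0 < mu -> 0 < s' -> s' < s -> s <= kappa ->
  (forall M, exists j n m e, (M <= j)%N /\ good_scale y mu s j n m e) ->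
  hausdorff s' (Fset y mu `&` @K R) <> 0%E.
Proof.
move=> mu0 s'0 ss' sk H.
have /choice[f fP] : forall M, exists x : nat * nat * nat * (seq bool -> seq bool),
    (M <= x.1.1.1)%N /\ good_scale y mu s x.1.1.1 x.1.1.2 x.1.2 x.2.
  by move=> M; have [j [n [m [e He]]]] := H M; exists (j, n, m, e).
exact: (hausdorff_Fset_construction mu0 s'0 ss' sk fP).
Qed.

End Scales.

(** * Counting reduced fractions *)

Section Counting.
Local Open Scope nat_scope.

Definition Plevel (j : nat) : seq (nat * nat) :=
  [seq pq <- [seq (p, q) | q <- iota (3 ^ j) (3 ^ j.+1 - 3 ^ j), p <- iota 0 q]
   | coprime pq.1 pq.2].

Lemma mem_Plevel j pq :
  (pq \in Plevel j) = [&& 3 ^ j <= pq.2 < 3 ^ j.+1, pq.1 < pq.2 & coprime pq.1 pq.2].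
Proof.
rewrite mem_filter andbC andbA; congr andb; case: pq => p q /=.
have -> : (3 ^ j <= q < 3 ^ j.+1) = (q \in iota (3 ^ j) (3 ^ j.+1 - 3 ^ j)).
  by rewrite mem_iota subnKC // leq_exp2l.
apply/allpairsPdep/andP => [[q' [p' [q'j p'q [-> ->]]]]|[qj pq]].
  by move: p'q; rewrite mem_iota.
by exists q, p; split => //; rewrite mem_iota.
Qed.

Lemma Plevel_Pcal j pq : pq \in Plevel j -> Pcal pq.
Proof. by rewrite mem_Plevel => /and3P[_ ? ?]. Qed.

Lemma Pcal_Plevel pq : Pcal pq -> exists j, pq \in Plevel j.
Proof.
case: pq => p q [/= pq cpq]; exists (trunc_log 3 q).
rewrite mem_Plevel /= pq cpq !andbT trunc_logP ?trunc_log_ltn //.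
exact: leq_ltn_trans pq.
Qed.

Lemma uniq_Plevel j : uniq (Plevel j).
Proof.
apply/filter_uniq/allpairs_uniq_dep => [|q _|[q p] [q' p'] _ _ [-> ->] //].
- exact: iota_uniq.
- exact: iota_uniq.
Qed.

Lemma sum_Plevel (f : nat * nat -> nat) j : \sum_(pq <- Plevel j) f pq =
  \sum_(3 ^ j <= q < 3 ^ j.+1) \sum_(0 <= p < q) coprime p q * f (p, q).
Proof.
rewrite big_filter big_mkcond big_allpairs_dep /= /index_iota.
apply: eq_bigr => q _; rewrite subn0; apply: eq_bigr => p _.
by case: coprime; rewrite ?mul1n ?mul0n.
Qed.

Lemma countPjE P' j : countPj P' j = count (fun pq => `[< P' pq >]) (Plevel j).
Proof.
rewrite -sum1_count big_mkcond /= sum_Plevel /countPj.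
rewrite -(big_mkord xpredT (fun q => \sum_(p < q) nat_of_bool
  `[< P' (nat_of_ord p, q) /\ Pcal (nat_of_ord p, q) /\ 3 ^ j <= q >])).
rewrite (big_cat_nat (leq0n _) (_ : 3 ^ j <= 3 ^ j.+1)) ?leq_exp2l //=.
rewrite big1_seq => [|q]; last first.
  rewrite mem_index_iota => /andP[_ qj]; rewrite big1 // => p _.
  by rewrite asboolF // => -[_ [_]]; rewrite leqNgt; case/andP: qj => _ ->.
rewrite add0n; apply: eq_big_nat => q /andP[jq _]; rewrite big_mkord.
apply: eq_bigr => p _; case: (asboolP (P' _)) => Pp; last first.
  by rewrite muln0 asboolF // => -[].
rewrite muln1; congr nat_of_bool; apply/asboolP/idP => [[_ [[]]]//|c].
by split => //; split => //; split => //=.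
Qed.

Lemma size_Plevel j : size (Plevel j) = \sum_(3 ^ j <= q < 3 ^ j.+1) totient q.
Proof.
rewrite -sum1_size sum_Plevel; apply: eq_bigr => q _.
rewrite totient_count_coprime; apply: eq_bigr => p _.
by rewrite muln1 coprime_sym.
Qed.

Lemma size_Plevel_le j : size (Plevel j) <= 9 ^ j.+1.
Proof.
rewrite size_Plevel; apply: (@leq_trans (\sum_(3 ^ j <= q < 3 ^ j.+1) 3 ^ j.+1)).
  rewrite big_nat_cond [leqRHS]big_nat_cond; apply: leq_sum => q /andP[/andP[_ qj] _].
  apply: leq_trans (ltnW qj); rewrite totient_count_coprime.
  apply: leq_trans (leq_sum _ (fun i _ => leq_b1 _)) _.
  by rewrite sum_nat_const_nat subn0 muln1.
by rewrite sum_nat_const_nat -[9]/(3 * 3) expnMn leq_mul2r leq_subr orbT.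
Qed.

(* Gauss: summing [\sum_(d | n) totient d = n] over n <= M. *)
Lemma sum_totient_divn M :
  \sum_(1 <= n < M.+1) n = \sum_(1 <= d < M.+1) totient d * (M %/ d).
Proof.
transitivity (\sum_(1 <= n < M.+1) \sum_(1 <= d < M.+1) (d %| n) * totient d).
  apply: eq_big_nat => n /andP[n0 nM]; rewrite -{1}(sum_totient_dvd n).
  rewrite -(big_mkord (fun d => d %| n) totient) big_mkcond /=.
  rewrite big_ltn // dvd0n gtn_eqF // add0n [RHS](big_cat_nat (n := n.+1)) //=.
  rewrite [X in _ = _ + X]big1_seq ?addn0 => [|d].
    by apply: eq_bigr => d _; case: (_ %| _); rewrite ?mul1n ?mul0n.
  by rewrite mem_index_iota => /andP[_ /andP[nd _]]; rewrite gtnNdvd ?mul0n.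
rewrite exchange_big /=; apply: eq_bigr => d _; rewrite divn_count_dvd big_distrr /=.
by apply: eq_bigr => n _; rewrite mulnC.
Qed.

(* With N = 3^j and M = 3N - 1, Gauss's sum is M(M+1)/2, its part below N is at most
   (N-1)M, and [M %/ d <= 2] in the part from N on. *)
Lemma size_Plevel_ge j : 9 ^ j <= 2 * size (Plevel j).
Proof.
rewrite size_Plevel; set N := 3 ^ j; have N0 : 0 < N by rewrite expn_gt0.
rewrite -[9]/(3 * 3) expnMn expnS -/N; pose M := (3 * N).-1.
have MS : M.+1 = 3 * N by rewrite prednK // muln_gt0.
have := sum_totient_divn M; rewrite MS.
rewrite [X in _ = X](big_cat_nat (n := N)) //=; last by rewrite leq_pmull.
have H1 : \sum_(1 <= d < N) totient d * (M %/ d) <= N.-1 * M.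
  apply: (@leq_trans (\sum_(1 <= d < N) M)); last by rewrite sum_nat_const_nat subn1.
  apply: leq_sum => d _; apply: leq_trans (leq_trunc_div M d); rewrite mulnC leq_mul2l.
  rewrite totient_count_coprime.
  apply/orP; right; apply: leq_trans (leq_sum _ (fun i _ => leq_b1 _)) _.
  by rewrite sum_nat_const_nat subn0 muln1.
have H2 : \sum_(N <= d < 3 * N) totient d * (M %/ d) <=
    2 * \sum_(N <= d < 3 * N) totient d.
  rewrite big_distrr /= big_nat_cond [leqRHS]big_nat_cond; apply: leq_sum => d /andP[/andP[Nd _] _].
  rewrite mulnC leq_mul2r -[M %/ d <= 2]ltnS ltn_divLR ?(leq_trans N0) //.
  by apply/orP; right; move: Nd MS; lia.
have : 2 * \sum_(1 <= n < 3 * N) n = 3 * N * M.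
  rewrite -MS; elim: (M) => [|K IH]; first by rewrite big_geq.
  by rewrite big_nat_recr //= mulnDr IH; nia.
by nia.
Qed.

End Counting.

(** * Counts extracted from the growth exponent *)

Section Sigma.
Context {R : realType}.
Variables (PK : set (nat * nat)).

Lemma sigmaP_lt (x : R) : (@sigmaP R PK < x%:E)%E ->
  \forall j \near \oo, (countPj PK j)%:R <= 3 `^ (x * j%:R) :> R.
Proof.
move=> /ereal_inf_lt[_ [V Voo <-] Vx].
near=> j; have Vj : V j by near: j.
have j0 : (0 < j)%N by near: j; exact: nbhs_infty_gt.
have [->|c0] := eqVneq (countPj PK j) 0%N; first by rewrite powR_ge0.
have := le_lt_trans (ereal_sup_ubound (_ : _ ((fun j : nat => if countPj PK j == 0%N then -oo%E
    else (ln (countPj PK j)%:R / (j%:R * ln 3))%:E) j))) Vx.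
rewrite (negbTE c0) => /(_ (ex_intro2 _ _ j Vj _)); rewrite (negbTE c0) => /(_ erefl).
rewrite lte_fin ltr_pdivrMr ?mulr_gt0 ?ltr0n ?ln3_gt0 // mulrA => /ltW.
by rewrite -(ler_expR (ln _)) lnK ?posrE ?ltr0n ?lt0n // /powR pnatr_eq0.
Unshelve. all: by end_near. Qed.

Lemma sigmaP_gt (x : R) : (x%:E < @sigmaP R PK)%E ->
  forall M, exists2 j, (M <= j)%N & 3 `^ (x * j%:R) <= (countPj PK j)%:R :> R.
Proof.
move=> xs M; apply: contrapT => H; move: xs; apply/negP; rewrite -leNgt.
(* The tail starts at [M.+1] so that [j] is positive and the quotient by [j * ln 3] can be
   cleared. *)
apply: (@le_trans _ _ (ereal_sup [set (fun j : nat => if countPj PK j == 0%N then -oo%E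
    else (ln (countPj PK j)%:R / (j%:R * ln 3))%:E) j | j in [set j | (M.+1 <= j)%N]])).
  apply: ereal_inf_lbound; exists [set j | (M.+1 <= j)%N] => //.
  exact: nbhs_infty_ge.
apply: ge_ereal_sup => _ [j /= Mj <-]; case: eqVneq => [_|c0]; first by rewrite leNye.
rewrite lee_fin leNgt; apply/negP => xj; apply: H; exists j; first exact: ltnW.
rewrite /powR pnatr_eq0 /= -[leRHS]lnK ?posrE ?ltr0n ?lt0n // ler_expR.
move: xj; rewrite ltr_pdivlMr; first by rewrite mulrA => /ltW.
by rewrite mulr_gt0 ?ln3_gt0 // ltr0n; apply: leq_ltn_trans Mj.
Qed.

End Sigma.

(** * Random points hitting cylinders *)

Section Words.

Definition words n : seq (seq bool) := [seq tval t | t <- enum {: n.-tuple bool}].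

Lemma mem_words n u : (u \in words n) = (size u == n).
Proof.
apply/mapP/idP => [[t _ ->]|un]; first by rewrite size_tuple.
by exists (Tuple un); rewrite ?mem_enum.
Qed.

Lemma size_words n : size (words n) = (2 ^ n)%N.
Proof. by rewrite size_map -cardE card_tuple card_bool. Qed.

Lemma uniq_words n : uniq (words n).
Proof. by rewrite map_inj_uniq ?enum_uniq //; exact: val_inj. Qed.

End Words.

Section Translation.
Context {R : realType}.

(** Exchanging the first digits shifts all later partial sums by one and the same constant, hence
    also their limit. *)
Lemma cantor_pt_subst (a : nat -> bool) (u v : seq bool) :
  size u = size v -> mkseq a (size v) = v ->
  cantor_pt (fun i => if (i < size u)%N then nth false u i else a i) =
  cantor_pt a - (wval v - wval u) :> R.
Proof.
move=> uv av; set b := fun i => _.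
have bu : mkseq b (size u) = u.
  by apply/mkseq_eqP => i iu; rewrite /b iu.
have E k : cpart b (size v + k) = cpart a (size v + k) - (wval v - wval u) :> R.
  elim: k => [|k IH].
    by rewrite addn0 (cpart_prefix av) -uv (cpart_prefix bu); lra.
  by rewrite addnS !cpartS IH /b uv ltnNge leq_addr /=; lra.
apply/eqP; rewrite -subr_eq0 -normr_le0 leNgt; apply/negP => /inv3_small[k].
apply/negP; rewrite -leNgt ler_norml.
have := cantor_pt_bound (R := R) a (size v + k).
have := cantor_pt_bound (R := R) b (size v + k); rewrite E.
have : 3 ^- (size v + k) <= 3 ^- k :> R.
  by rewrite lef_pV2 ?posrE ?exprn_gt0 // ler_weXn2l ?ler1n // leq_addl.
by lra.
Qed.

(** Exchanging the prefix [v] for [u] translates [cyl v] within the Cantor set onto [cyl u]. By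
    symmetry, cylinders of one level have equal Hausdorff measure. *)
Lemma hausdorff_cyl_le (s : R) (u v : seq bool) : 0 <= s -> size u = size v ->
  (hausdorff s (cyl v `&` @K R) <= hausdorff s (cyl u `&` @K R))%E.
Proof.
move=> s0 uv; apply: (@hausdorff_translate_le _ _ (wval v - wval u)) => //; move=> x [xv [[a xa] _]].
  exact: cyl_Trep xv.
have {xa} xa : x = cantor_pt a by []; rewrite xa in xv *.
move: xv => ya.
have av := cyl_cantor_pt ya; have E := cantor_pt_subst uv av.
have uy : cyl u (cantor_pt a - (wval v - wval u) : R).
  by move: ya; rewrite /cyl /= !in_itv /= uv; lra.
split => //; split; last exact: (cyl_Trep uy).
by rewrite -E; eexists.
Qed.

Lemma lebesgue_cyl (v : seq bool) :
  lebesgue_measure (cyl v `&` @Trep R) = (3 ^- size v)%:E.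
Proof.
rewrite setIidl; last exact: cyl_Trep.
rewrite /cyl lebesgue_measure_itv /= lte_fin ltrDl inv3_gt0 -EFinB.
by congr _%:E; lra.
Qed.

End Translation.

Lemma measure_bigsetU_le {R : realType} {d : measure_display} {T : measurableType d}
    (P : {measure set T -> \bar R}) (I : Type) (r : seq I) (F : I -> set T) :
  (forall i, measurable (F i)) ->
  (P (\big[setU/set0]_(i <- r) F i) <= \sum_(i <- r) P (F i))%E.
Proof.
move=> mF; elim: r => [|i r IH]; first by rewrite !big_nil measure0.
rewrite !big_cons; apply: le_trans (measureU2 _ _ _) _ => //.
  exact: bigsetU_measurable.
by rewrite leeD2l.
Qed.

Section ProbabilityLemmas.
Context {R : realType} {d : measure_display} {Omega : measurableType d}.
Variable P : probability Omega R.

(** The event that [B j] holds for all [j >= M] lies in each of these [B j], some of which have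
    arbitrarily small probability. *)
Lemma ae_frequently (B : nat -> set Omega) :
  (forall j, measurable (B j)) ->
  (forall M e, 0 < e -> exists2 j, (M <= j)%N & (P (B j) <= e%:E)%E) ->
  {ae P, forall w, forall M, exists2 j, (M <= j)%N & ~ B j w}.
Proof.
move=> mB PB; apply: ae_foralln => M.
have mN : measurable (\bigcap_(j in [set j | (M <= j)%N]) B j).
  by apply: bigcap_measurable => //; exists M => /=.
exists (\bigcap_(j in [set j | (M <= j)%N]) B j); split => //.
  apply/eqP; rewrite eq_le measure_ge0 andbT; apply/lee_addgt0Pr => e e0.
  have [j Mj Pj] := PB M e e0; rewrite add0e; apply: le_trans Pj.
  by apply: le_measure; rewrite ?inE // => w; exact.
move=> w /= H j Mj; apply: contrapT => Bj; apply: H; by exists j.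
Qed.

Variable Y : nat * nat -> Omega -> R.
Hypothesis mY : forall pq, Pcal pq -> measurable_fun setT (Y pq).

Lemma measurable_preY pq B : Pcal pq -> measurable B -> measurable (Y pq @^-1` B).
Proof. by move=> Ppq mB; rewrite -[_ @^-1` _]setTI; exact: mY. Qed.

Hypothesis indep : forall (s : seq (nat * nat)) (B : nat * nat -> set R),
  uniq s -> (forall pq, pq \in s -> Pcal pq) -> (forall pq, measurable (B pq)) ->
  fine (P (\bigcap_(pq in [set pq | pq \in s]) (Y pq @^-1` B pq))) =
  \prod_(pq <- s) fine (P (Y pq @^-1` B pq)).

Definition avoid (S : seq (nat * nat)) (A : set R) : set Omega :=
  \bigcap_(pq in [set pq | pq \in S]) (Y pq @^-1` (~` A)).

Lemma measurable_avoid S A : (forall pq, pq \in S -> Pcal pq) -> measurable A ->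
  measurable (avoid S A).
Proof.
move=> SP mA; apply: fin_bigcap_measurable; first exact: finite_seq.
by move=> pq /= /SP Ppq; apply: measurable_preY => //; exact: measurableC.
Qed.

(** Independence factors the common miss into single misses, each of probability at most [1 - p]. *)
Lemma prob_avoid S (A : set R) (p : R) : uniq S -> (forall pq, pq \in S -> Pcal pq) ->
  measurable A -> (forall pq, pq \in S -> (p%:E <= P (Y pq @^-1` A))%E) ->
  (P (avoid S A) <= ((1 - p) ^+ size S)%:E)%E.
Proof.
move=> uS SP mA pA; have mS := measurable_avoid SP mA.
rewrite -(fineK (fin_num_measure P _ mS)) lee_fin.
rewrite (indep (B := fun=> ~` A)) //; last by move=> _; exact: measurableC.
have -> : (1 - p) ^+ size S = \prod_(pq <- S) (1 - p).
  by rewrite big_const_seq count_predT; elim: (size S) => [//|n IH]; rewrite exprS IH.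
rewrite [leLHS]big_seq [leRHS]big_seq; apply: ler_prod => pq pqS.
have mYA : measurable (Y pq @^-1` A) by apply: measurable_preY => //; exact: SP.
rewrite fine_ge0 // preimage_setC probability_setC //.
have := pA _ pqS; rewrite -(fineK (fin_num_measure P _ mYA)) lee_fin.
by rewrite -EFinB /=; lra.
Qed.

Definition ext_cyl (n m : nat) (u : seq bool) : set R :=
  \bigcup_(w in [set` words (m - n)]) cyl (u ++ w).

Lemma measurable_ext_cyl n m u : measurable (ext_cyl n m u).
Proof.
apply: fin_bigcup_measurable; first exact: finite_seq.
by move=> w _; exact: measurable_cyl.
Qed.

(** The [2 ^ (m - n)] extensions of [u] to length [m] have disjoint cylinders, each of mass at least
    [rho ^+ m]. *)
Lemma prob_ext_cyl pq n m u (rho : R) : Pcal pq -> (n <= m)%N -> size u = n ->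
  (forall v, ((rho ^+ size v)%:E <= P (Y pq @^-1` cyl v))%E) ->
  ((2 ^+ (m - n) * rho ^+ m)%:E <= P (Y pq @^-1` ext_cyl n m u))%E.
Proof.
move=> Ppq nm un Hrho; rewrite /ext_cyl preimage_bigcup measure_fin_bigcup.
- rewrite -fsbig_seq ?uniq_words //.
  apply: (@le_trans _ _ (\sum_(i <- words (m - n)) (rho ^+ m)%:E)%E).
    rewrite sumEFin big_const_seq count_predT size_words -natrX mulr_natl.
    by rewrite lee_fin; elim: (2 ^ _)%N => [//|k IH]; rewrite mulrS lerD2l.
  rewrite [leLHS]big_seq [leRHS]big_seq; apply: lee_sum => w; rewrite mem_words => /eqP wm.
  by apply: le_trans (Hrho _); rewrite size_cat un wm subnKC.
- exact: finite_seq.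
- move=> w w' /=; rewrite !mem_words => /eqP wm /eqP wm' [x [/= xw xw']].
  have /eqP : u ++ w = u ++ w'.
    by apply: (cyl_inj _ xw xw'); rewrite !size_cat wm wm'.
  by rewrite eqseq_cat // eqxx => /eqP.
- by move=> w _; apply: measurable_preY => //; exact: measurable_cyl.
Qed.

(** A union bound over the [2 ^ n] words. With [p] the bound of [prob_ext_cyl] and [N] points, some
    word is missed with probability at most [2 ^ n (1 - p) ^ N <= e ^ n e ^ (- p N) <= e ^ (- n)],
    the last step using [2 n <= p N]. *)
Lemma good_words_frequently (S : nat -> seq (nat * nat)) (n m : nat -> nat) (rho : R) :
  (forall j, uniq (S j)) -> (forall j pq, pq \in S j -> Pcal pq) ->
  (forall j pq, pq \in S j ->
     forall v, ((rho ^+ size v)%:E <= P (Y pq @^-1` cyl v))%E) ->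
  (forall M, exists j, [/\ (M <= j)%N, (M <= n j)%N, (n j <= m j)%N &
     (n j)%:R * 2 <= 2 ^+ (m j - n j) * rho ^+ m j * (size (S j))%:R]) ->
  {ae P, forall w, forall M, exists j, [/\ (M <= j)%N, (n j <= m j)%N &
     forall u, size u = n j -> exists v, [/\ size v = m j, take (n j) v = u &
       exists2 pq, pq \in S j & cyl v (Y pq w)]]}.
Proof.
move=> uS SP Srho H.
(* The bad event at scale [j]. It is everything when [n j > m j], so that its failure also yields
   [n j <= m j]. *)
pose B j := if (n j <= m j)%N then
  \big[setU/set0]_(u <- words (n j)) avoid (S j) (ext_cyl (n j) (m j) u) else setT.
have mB j : measurable (B j).
  rewrite /B; case: ifP => // _; apply: bigsetU_measurable => u _.
  by apply: measurable_avoid; [exact: SP|exact: measurable_ext_cyl].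
have PB M e : 0 < e -> exists2 j, (M <= j)%N & (P (B j) <= e%:E)%E.
  move=> e0; have [j [Mj nj nm pN]] := H (maxn M (Num.truncn e^-1).+1).
  exists j; first by apply: leq_trans Mj; exact: leq_maxl.
  rewrite /B nm; apply: le_trans (measure_bigsetU_le P _ _) _ => [u|].
    by apply: measurable_avoid; [exact: SP|exact: measurable_ext_cyl].
  set p := 2 ^+ (m j - n j) * rho ^+ m j in pN.
  apply: (@le_trans _ _ (\sum_(u <- words (n j)) ((1 - p) ^+ size (S j))%:E)%E).
    rewrite [leLHS]big_seq [leRHS]big_seq; apply: lee_sum => u; rewrite mem_words => /eqP un.
    apply: prob_avoid; [exact: uS|exact: SP|exact: measurable_ext_cyl|move=> pq pqS].
    apply: prob_ext_cyl => // [|v]; [exact: SP pqS|exact: Srho pqS _].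
  have n0 : (0 < n j)%N by apply: leq_trans nj; rewrite leq_max orbT.
  rewrite sumEFin lee_fin big_const_seq count_predT size_words.
  rewrite iter_addr_0 -mulr_natl.
  set N := size (S j) in pN *.
  have N0 : (0 < N)%N.
    rewrite lt0n; apply/eqP => N0; move: pN; rewrite N0 mulr0 leNgt => /negP; apply.
    by rewrite mulr_gt0 // ltr0n.
  (* Needed for [1 - p >= 0], without which its powers could not be compared with those of
     [expR (- p)]. *)
  have p1 : p <= 1.
    have [pq pqS] : exists pq, pq \in S j.
      by move: N0; rewrite /N; case: (S j) => // x r _; exists x; rewrite mem_head.
    rewrite -lee_fin; apply: le_trans (prob_ext_cyl (u := nseq (n j) false) (SP _ _ pqS) nm _
      (Srho _ _ pqS)) _; first by rewrite size_nseq.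
    by apply: probability_le1; apply: measurable_preY (SP _ _ pqS) (measurable_ext_cyl _ _ _).
  apply: (@le_trans _ _ (expR (- (n j)%:R))).
    have -> : expR (- (n j)%:R) = expR 1 ^+ n j * expR (- ((n j)%:R * 2)) :> R.
      by rewrite -expRM_natl mulr1 -expRD; congr expR; lra.
    rewrite natrX; apply: ler_pM; rewrite ?exprn_ge0 ?subr_ge0 //.
      by rewrite lerXn2r ?nnegrE ?expR_ge0 //; have := expR_ge1Dx (1 : R); lra.
    apply: (@le_trans _ _ (expR (- p) ^+ N)).
      by rewrite lerXn2r ?nnegrE ?subr_ge0 ?expR_ge0 //; exact: expR_ge1Dx.
    by rewrite -expRM_natl ler_expR; lra.
  rewrite expRN -[leRHS]invrK lef_pV2 ?posrE ?invr_gt0 ?expR_gt0 //.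
  apply: le_trans (_ : (n j)%:R <= _); last by have := expR_ge1Dx ((n j)%:R : R); lra.
  apply: ltW; apply: lt_le_trans (truncnS_gt _) _; rewrite ler_nat.
  by apply: leq_trans nj; exact: leq_maxr.
apply: filterS (ae_frequently mB PB) => w Hw M.
have [j Mj] := Hw M; rewrite /B; case: ifP => nm; last by move=> []. 
rewrite -bigcup_seq => Bj.
exists j; split => // u un; apply: contrapT => nu; apply: Bj.
exists u; first by rewrite /= mem_words un.
move=> pq /= pqS [w' /=]; rewrite mem_words => /eqP w'm Yw; apply: nu.
exists (u ++ w'); rewrite size_cat un w'm subnKC // take_size_cat //.
by split => //; exists pq.
Qed.

End ProbabilityLemmas.

(** * Lengths of words and extensions at a given scale *)

Section ScaleParameters.
Context {R : realType}.
Local Notation kappa := (@kappa R).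
Variables (mu s : R).

Definition ext_length (j : nat) : nat := (Num.truncn (j.+1%:R * mu)).+1.

Definition word_length (j : nat) : nat := Num.truncn (s / kappa * (ext_length j)%:R).

Hypotheses (mu0 : 0 < mu) (s0 : 0 < s) (sk : s <= kappa).

Let theta_gt0 : 0 < s / kappa.
Proof. by rewrite divr_gt0 ?kappa_gt0. Qed.

Lemma ext_length_itv j : j.+1%:R * mu <= (ext_length j)%:R <= j.+1%:R * mu + 1.
Proof.
rewrite /ext_length; have : 0 <= j.+1%:R * mu by rewrite mulr_ge0 // ltW.
by move: (_ * mu) => x /truncn_itv; rewrite -!natr1; lra.
Qed.

Lemma word_length_itv j :
  s / kappa * (ext_length j)%:R - 1 < (word_length j)%:R <= s / kappa * (ext_length j)%:R.
Proof.
rewrite /word_length.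
have : 0 <= s / kappa * (ext_length j)%:R by rewrite mulr_ge0 // ltW.
by move: (_ * _%:R) => x /truncn_itv; rewrite -!natr1; lra.
Qed.

Lemma word_length_le j : (word_length j <= ext_length j)%N.
Proof.
rewrite -(ler_nat R); have /andP[_ /le_trans] := word_length_itv j; apply.
by rewrite -[leRHS]mul1r ler_wpM2r // ler_pdivrMr ?kappa_gt0 // mul1r.
Qed.

Lemma word_length_ge M : exists J, forall j, (J <= j)%N -> (M <= word_length j)%N.
Proof.
exists (Num.truncn (M.+1%:R / (s / kappa * mu))).+1 => j Jj; rewrite -ltnS -(ler_nat R).
have /andP[/ltW + _] := word_length_itv j; have /andP[+ _] := ext_length_itv j.
move=> Hm Hn; rewrite -[leRHS]natr1 -lerBlDr.
apply: le_trans Hn; rewrite lerD2r; apply: le_trans (_ : s / kappa * (j.+1%:R * mu) <= _).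
  rewrite mulrCA -ler_pdivrMr ?(mulr_gt0 theta_gt0 mu0) //; apply: ltW.
  by apply: lt_le_trans (truncnS_gt _) _; rewrite ler_nat leqW.
by rewrite ler_wpM2l // ltW.
Qed.

(** A superlinear lower bound, meant to beat the linear growth of [word_length]; it is the square of
    [1 + x <= expR x]. *)
Lemma powR3_ge_sqr (x : R) : 0 <= x -> (ln 3 / 2 * x) ^+ 2 <= 3 `^ x.
Proof.
move=> x0; rewrite /powR pnatr_eq0 /= (_ : x * ln 3 = 2%:R * (ln 3 / 2 * x)); last by lra.
rewrite expRM_natl lerXn2r ?nnegrE ?expR_ge0 //.
  by rewrite mulr_ge0 // divr_ge0 // ltW // ln3_gt0.
by have := expR_ge1Dx (ln 3 / 2 * x); lra.
Qed.

(** [r] is the decay exponent of cylinder masses and [alpha] the growth exponent of the number of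
    points. As [kappa n <= s m], the exponent of the expected number of hits is at least
    [alpha j - (s + r - kappa) m], which is at least [delta j - beta]. *)
Lemma expected_hits_ge (r alpha c : R) : kappa <= r -> 0 < c ->
  (s + r - kappa) * mu < alpha ->
  exists J, forall j N, (J <= j)%N -> c * 3 `^ (alpha * j%:R) <= N%:R ->
    (word_length j)%:R * 2 <=
      2 ^+ (ext_length j - word_length j) * (3 `^ (- r)) ^+ ext_length j * N%:R.
Proof.
(* [beta] collects the rounding in [m <= j mu + (mu + 1)], and [delta] is the slack in the
   exponent. *)
move=> kr c0 Ha; pose beta := (s + r - kappa) * (mu + 1); pose delta := alpha - (s + r - kappa) * mu.
have delta0 : 0 < delta by rewrite subr_gt0.
pose a := ln 3 / 2 * delta; have a0 : 0 < a by rewrite !mulr_gt0 ?ln3_gt0 ?invr_gt0.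
pose c1 := c * 3 `^ (- beta); have c10 : 0 < c1 by rewrite mulr_gt0 ?powR3_gt0.
(* From this scale on [(4 mu + 2) j <= c1 (a j) ^ 2], and the left side dominates [2 n] because
   [n <= m <= 2 mu j + 1]. *)
exists (Num.truncn ((4 * mu + 2) / (a ^+ 2 * c1))).+1 => j N Jj cN.
have j1 : (1 <= j)%N by apply: leq_trans Jj.
have jr1 : 1 <= j%:R :> R by rewrite ler1n.
have /andP[mj1 mj2] := ext_length_itv j; have /andP[nj1 nj2] := word_length_itv j.
have kn : kappa * (word_length j)%:R <= s * (ext_length j)%:R.
  by rewrite -ler_pdivlMl ?kappa_gt0 // mulrA (mulrC _ s).
have nm : ((word_length j)%:R : R) <= (ext_length j)%:R.
  by rewrite ler_nat word_length_le.
have two_pow k : 2 ^+ k = 3 `^ (kappa * k%:R) :> R.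
  by rewrite powRrM powR_kappa powR_mulrn.
have rho_pow k : (3 `^ (- r)) ^+ k = 3 `^ (- r * k%:R) :> R.
  by rewrite powRrM powR_mulrn ?powR_ge0.
apply: (@le_trans _ _ (c1 * 3 `^ (delta * j%:R))).
  apply: (@le_trans _ _ ((4 * mu + 2) * j%:R)).
    have : (j.+1)%:R * mu <= j%:R * 2 * mu by rewrite ler_wpM2r ?(ltW mu0) // -natr1; lra.
    by lra.
  apply: (@le_trans _ _ (c1 * (a * j%:R) ^+ 2)); last first.
    rewrite ler_wpM2l ?(ltW c10) // /a -mulrA; apply: powR3_ge_sqr.
    by rewrite mulr_ge0 // ltW.
  have Hj : (4 * mu + 2) / (a ^+ 2 * c1) <= j%:R.
    by apply: ltW; apply: lt_le_trans (truncnS_gt _) _; rewrite ler_nat.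
  rewrite ler_pdivrMr ?(mulr_gt0 (exprn_gt0 2 a0) c10) // in Hj.
  rewrite (_ : c1 * _ = j%:R * (a ^+ 2 * c1) * j%:R); last by ring.
  by rewrite ler_wpM2r.
rewrite two_pow rho_pow -powR3D natrB ?word_length_le //.
apply: (@le_trans _ _ (3 `^ (kappa * ((ext_length j)%:R - (word_length j)%:R) +
    - r * (ext_length j)%:R) * (c * 3 `^ (alpha * j%:R)))); last by rewrite ler_wpM2l ?powR_ge0.
rewrite [leRHS]mulrCA /c1 -[leLHS]mulrA ler_wpM2l ?(ltW c0) // -!powR3D ler_powR3 /delta /beta.
have : (s + r - kappa) * (ext_length j)%:R <= (s + r - kappa) * ((j%:R + 1) * mu + 1).
  rewrite ler_wpM2l ?natr1 //; by move: kr s0; lra.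
by move: kn; lra.
Qed.

End ScaleParameters.

(** * Almost sure existence of good scales for both laws *)

Section FrequentScales.
Context {R : realType} {d : measure_display} {Omega : measurableType d}.
Variables (P : probability Omega R) (PK : set (nat * nat)) (Y : nat * nat -> Omega -> R).
Local Notation kappa := (@kappa R).
Hypothesis mY : forall pq, Pcal pq -> measurable_fun setT (Y pq).
Hypothesis sigmaK : @sigmaP R PK = kappa%:E.
Hypothesis PK_law : forall pq, PK pq -> forall B : set R, measurable B ->
  P (Y pq @^-1` B) =
  (hausdorff kappa (B `&` @K R) * ((fine (hausdorff kappa (@K R)))^-1)%:E)%E.
Hypothesis nPK_law : forall pq, Pcal pq -> ~ PK pq -> forall B : set R, measurable B ->
  P (Y pq @^-1` B) = lebesgue_measure (B `&` @Trep R).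
Hypothesis indep : forall (s : seq (nat * nat)) (B : nat * nat -> set R),
  uniq s -> (forall pq, pq \in s -> Pcal pq) -> (forall pq, measurable (B pq)) ->
  fine (P (\bigcap_(pq in [set pq | pq \in s]) (Y pq @^-1` B pq))) =
  \prod_(pq <- s) fine (P (Y pq @^-1` B pq)).

(** The [2 ^ m] cylinders of a level have equal mass and cover [K] up to finitely many right ends,
    which are null. The total mass is 1 because [P] is a probability, so each cylinder has mass at
    least [2 ^ (- m)]. *)
Lemma prob_cyl_PK pq v : PK pq -> Pcal pq ->
  (((3 `^ (- kappa)) ^+ size v)%:E <= P (Y pq @^-1` cyl v))%E.
Proof.
move=> Kpq Ppq; have mYv u : measurable (Y pq @^-1` cyl u).
  by apply: measurable_preY => //; exact: measurable_cyl.
pose Q B := P (Y pq @^-1` B); pose c : R := (fine (hausdorff kappa (@K R)))^-1.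
have c0 : (0 <= c%:E)%E by rewrite lee_fin invr_ge0 fine_ge0 // hausdorff_ge0.
have Qle B B' : measurable B -> measurable B' ->
    (hausdorff kappa (B `&` @K R) <= hausdorff kappa (B' `&` @K R))%E -> (Q B <= Q B')%E.
  by move=> mB mB' H; rewrite /Q !PK_law //; exact: lee_wpmul2r.
have Q1 (e : R) : Q [set e] = 0%E.
  apply/eqP; rewrite eq_le measure_ge0 andbT /Q PK_law //.
  have [Te|nTe] := pselect (Trep e).
    rewrite (_ : hausdorff _ _ = 0%E) ?mul0e //; apply/eqP.
    rewrite eq_le hausdorff_ge0 andbT -(hausdorff_set1 (kappa_gt0 (R := R)) Te).
    by apply: hausdorff_le => [|y [_ []]//|y []//]; exact/ltW/kappa_gt0.
  (* A point outside [Trep] misses [K], so the set to be measured is empty and is compared with the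
     null set [{0}]. *)
  rewrite (_ : hausdorff _ _ = 0%E) ?mul0e //; apply/eqP.
  have T0 : Trep (0 : R) by rewrite /Trep /= in_itv /= lexx ltr01.
  rewrite eq_le hausdorff_ge0 andbT -(hausdorff_set1 (kappa_gt0 (R := R)) T0).
  apply: hausdorff_le => [|y [_ []]//|y [-> [_ /nTe]]//]; exact/ltW/kappa_gt0.
pose m := size v; pose C : set R := \big[setU/set0]_(u <- words m) cyl u.
pose E : set R := \big[setU/set0]_(u <- words m) [set wval u + 3 ^- m : R].
have mC : measurable C by apply: bigsetU_measurable => u _; exact: measurable_cyl.
have mE : measurable E by apply: bigsetU_measurable => u _; exact: measurable_set1.
have QE : Q (~` C) = 0%E.
  apply/eqP; rewrite eq_le measure_ge0 andbT; apply: (@le_trans _ _ (Q E)).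
    apply: Qle => //; first exact: measurableC.
    apply: hausdorff_le => [|y [_ []]//|y]; first exact/ltW/kappa_gt0.
    rewrite /C /E -!bigcup_seq => -[nC Ky]; split => //.
    case: Ky => -[a ya] _; have {}ya : y = cantor_pt a by [].
    exists (mkseq a m); first by rewrite /= mem_words size_mkseq.
    rewrite ya in nC *; have [|Cy|-> /=] := prefix_cyl (R := R) (a := a) (v := mkseq a m).
    - by rewrite size_mkseq.
    - by case: nC; exists (mkseq a m); first by rewrite /= mem_words size_mkseq.
    - by rewrite size_mkseq.
  have -> : Q E = P (\big[setU/set0]_(u <- words m) (Y pq @^-1` [set wval u + 3 ^- m])).
    by rewrite /Q /E -bigcup_seq preimage_bigcup bigcup_seq.
  apply: le_trans (measure_bigsetU_le P _ _) _ => [u|].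
    by apply: measurable_preY => //; exact: measurable_set1.
  by rewrite big1 // => u _; exact: Q1.
have : (1 <= Q C)%E.
  rewrite -(probability_setT P) -(preimage_setT (Y pq)) -(setUv C) preimage_setU.
  apply: le_trans (measureU2 _ _ _) _; [exact: measurable_preY| |by rewrite [X in (_ + X)%E](_ : _ = 0%E) ?adde0].
  by apply: measurable_preY => //; exact: measurableC.
have QC : (Q C <= \sum_(u <- words m) Q (cyl v))%E.
  have -> : Q C = P (\big[setU/set0]_(u <- words m) (Y pq @^-1` cyl u)).
    by rewrite /Q /C -bigcup_seq preimage_bigcup bigcup_seq.
  apply: le_trans (measure_bigsetU_le P _ mYv) _.
  rewrite [leLHS]big_seq [leRHS]big_seq; apply: lee_sum => u; rewrite mem_words => /eqP um.
  apply: Qle; [exact: measurable_cyl|exact: measurable_cyl|apply: hausdorff_cyl_le => //].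
  exact/ltW/kappa_gt0.
move=> /le_trans/(_ QC); rewrite /Q -(fineK (fin_num_measure P _ (mYv v))) sumEFin !lee_fin.
rewrite big_const_seq count_predT size_words iter_addr_0 -[fine _ *+ _]mulr_natl natrX.
by rewrite powRN powR_kappa exprVn -ler_pdivrMl ?exprn_gt0 // mulr1.
Qed.

Lemma prob_cyl_nPK pq v : ~ PK pq -> Pcal pq ->
  (((3 `^ (- 1)) ^+ size v)%:E <= P (Y pq @^-1` cyl v))%E.
Proof.
move=> nKpq Ppq; rewrite nPK_law // ?lebesgue_cyl ?powR_inv1 ?exprVn //.
exact: measurable_cyl.
Qed.

(** The common argument for both kinds of points: [r = kappa] for those of [PK], [r = 1] for the
    Lebesgue points. *)
Lemma good_scales_frequently (S : nat -> seq (nat * nat)) (mu s r alpha c : R) :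
  0 < mu -> 0 < s -> s <= kappa -> kappa <= r -> 0 < c ->
  (s + r - kappa) * mu < alpha ->
  (forall j, uniq (S j)) -> (forall j, {subset S j <= Plevel j}) ->
  (forall j pq, pq \in S j ->
     forall v, (((3 `^ (- r)) ^+ size v)%:E <= P (Y pq @^-1` cyl v))%E) ->
  (forall M, exists2 j, (M <= j)%N & c * 3 `^ (alpha * j%:R) <= (size (S j))%:R) ->
  {ae P, forall w, forall M, exists j n m e,
     (M <= j)%N /\ good_scale (fun pq => Y pq w) mu s j n m e}.
Proof.
move=> mu0 s0 sk kr c0 Ha uS SP Srho Hc.
have [J HJ] := expected_hits_ge mu0 s0 sk kr c0 Ha.
apply: filterS (good_words_frequently (n := word_length mu s) (m := ext_length mu)
    mY indep uS _ Srho _) => [w Hw M||M].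
- have [j [Mj nm Hj]] := Hw M; exists j, (word_length mu s j), (ext_length mu j).
  have /choice[e He] : forall u, exists v, size u = word_length mu s j ->
      [/\ size v = ext_length mu j, take (word_length mu s j) v = u &
       exists2 pq, pq \in S j & cyl v (Y pq w)].
    move=> u; have [/Hj[v Hv]|nu] := eqVneq (size u) (word_length mu s j); first by exists v.
    by exists u => /eqP; rewrite (negbTE nu).
  exists e; split => //; split => //.
  + by have /andP[] := word_length_itv mu s0 j.
  + by have /andP[] := ext_length_itv mu0 j.
  + move=> u /He[? ? [pq pqS Yv]]; split => //; exists pq; split => //.
      exact: Plevel_Pcal (SP _ _ pqS).
    by have := SP _ _ pqS; rewrite mem_Plevel => /and3P[].
- by move=> j pq /SP/Plevel_Pcal.
- have [J' HJ'] := word_length_ge mu0 s0 M.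
  have [j Mj cj] := Hc (maxn M (maxn J J')).
  move: Mj; rewrite !geq_max => /and3P[Mj Jj J'j].
  by exists j; split; [| exact: HJ'| exact: word_length_le| exact: HJ].
Qed.

Lemma good_scales_PK mu s : 0 < mu -> 0 < s -> s <= kappa -> s * mu < kappa ->
  {ae P, forall w, forall M, exists j n m e,
     (M <= j)%N /\ good_scale (fun pq => Y pq w) mu s j n m e}.
Proof.
move=> mu0 s0 sk smu.
pose S j := [seq pq <- Plevel j | `[< PK pq >]].
(* The midpoint [alpha] exceeds [s * mu], as the hit count requires, and stays below the growth
   exponent [kappa] of [PK]. *)
apply: (@good_scales_frequently S mu s kappa ((s * mu + kappa) / 2) 1) => //.
- by rewrite addrK; lra.
- by move=> j; rewrite filter_uniq ?uniq_Plevel.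
- by move=> j; exact: mem_subseq (filter_subseq _ _).
- move=> j pq; rewrite mem_filter => /andP[/asboolP Kpq /Plevel_Pcal Ppq] v.
  exact: prob_cyl_PK.
- move=> M; have [|j Mj Hj] := @sigmaP_gt R PK ((s * mu + kappa) / 2) _ M.
    by rewrite sigmaK lte_fin; lra.
  by exists j => //; rewrite mul1r size_filter -countPjE.
Qed.

Lemma good_scales_nPK mu s : 0 < mu -> 0 < s -> s <= kappa -> (s + 1 - kappa) * mu < 2 ->
  {ae P, forall w, forall M, exists j n m e,
     (M <= j)%N /\ good_scale (fun pq => Y pq w) mu s j n m e}.
Proof.
move=> mu0 s0 sk smu.
pose S j := [seq pq <- Plevel j | ~~ `[< PK pq >]].
(* A level has at least [9 ^ j / 2] fractions. For large [j] at most [3 ^ j] of them are in [PK],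
   which is at most [9 ^ j / 4] once [j >= 2]; this leaves [9 ^ j / 4]. *)
apply: (@good_scales_frequently S mu s 1 2 (1 / 4)) => //.
- exact/ltW/kappa_lt1.
- by move=> j; rewrite filter_uniq ?uniq_Plevel.
- by move=> j; exact: mem_subseq (filter_subseq _ _).
- move=> j pq; rewrite mem_filter => /andP[/asboolPn nKpq /Plevel_Pcal Ppq] v.
  exact: prob_cyl_nPK.
- move=> M; have : (@sigmaP R PK < 1%:E)%E by rewrite sigmaK lte_fin kappa_lt1.
  move=> /sigmaP_lt[J _ HJ]; pose j := maxn (maxn M J) 2; exists j.
    by rewrite /j !leq_max leqnn.
  have := HJ j; rewrite /= {1}/j !leq_max leqnn orbT => /(_ isT).
  have := size_Plevel_ge j; rewrite -(count_predC (fun pq => `[< PK pq >])) -countPjE.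
  rewrite -[count (predC _) _]size_filter -/(S j) -(ler_nat R) natrM natrD !natrX => H9.
  have j2 : (2 <= j)%N by rewrite leq_max orbT.
  have -> : 3 `^ (2 * j%:R) = 9%:R ^+ j :> R.
    by rewrite powRrM powR_mulrn // powR_mulrn ?exprn_ge0 // -natrX.
  rewrite (mul1r j%:R) powR_mulrn //.
  have : 4%:R * 3 ^+ j <= 9%:R ^+ j :> R.
    rewrite -!natrX -natrM ler_nat -(subnK j2) !expnD mulnCA.
    have : (3 ^ (j - 2) <= 9 ^ (j - 2))%N by case: (j - 2)%N => // k; rewrite leq_exp2r.
    by rewrite -[(9 ^ 2)%N]/81%N -[(3 ^ 2)%N]/9%N; lia.
  lra.
Qed.

End FrequentScales.

(** * The first moment bound *)

Section Series.
Context {R : realType}.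

(** Turns a cover indexed by level and rank into a sequence, the form of cover in [hausdorff_delta];
    surjectivity of [e] keeps it a cover. *)
Lemma nneseries_pair (g : nat * nat -> \bar R) : (forall x, (0 <= g x)%E) ->
  exists2 e : nat -> nat * nat, (forall x, exists i, e i = x) &
    (\sum_(0 <= i <oo) g (e i) = \sum_(0 <= j <oo) \sum_(0 <= l <oo) g (j, l))%E.
Proof.
move=> g0; have : ([set: nat] #= [set: nat * nat])%card by rewrite card_eq_sym; exact: card_nat2.
move=> /card_set_bijP[e be]; exists e.
  by move=> x; have [_ _ /(_ x I)[i _ <-]] := be; exists i.
rewrite nneseries_esumT // -(reindex_esum setT setT e g be).
rewrite [RHS]nneseries_esumT; last by move=> j; apply: nneseries_ge0.
rewrite (eq_esum (b := fun j => (\esum_(l in [set: nat]) g (j, l))%E)); last first.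
  by move=> j _; rewrite nneseries_esumT.
rewrite esum_esum //; rewrite (_ : _ `*`` _ = setT); last by apply/seteqP; split.
by apply: eq_esum => -[].
Qed.

Lemma nneseries_finite (n : nat) (h : nat -> \bar R) : (forall l, (0 <= h l)%E) ->
  (\sum_(0 <= l <oo) (if (l < n)%N then h l else 0) = \sum_(0 <= l < n) h l)%E.
Proof.
move=> h0; rewrite (nneseries_split 0 n) ?add0n; last by move=> k _; case: ifP.
rewrite eseries0 ?adde0 => [|i ni _]; last by rewrite ltnNge ni.
by apply: eq_big_nat => i /andP[_ ->].
Qed.

Lemma nneseries_lt_geom (f : nat -> R) (C rho : R) :
  (forall j, 0 <= f j) -> 0 <= C -> 0 <= rho < 1 ->
  (\forall j \near \oo, f j <= C * rho ^+ j) ->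
  (\sum_(0 <= j <oo) (f j)%:E < +oo)%E.
Proof.
move=> f0 C0 /andP[r0 r1] [J _ HJ].
rewrite (nneseries_split 0 J) ?add0n => [|k _]; last by rewrite lee_fin.
rewrite sumEFin lte_add_pinfty ?ltry //.
apply: (@le_lt_trans _ _ (C * rho ^+ J / (1 - rho))%:E); last by rewrite ltry.
apply: lime_le; first by apply: is_cvg_nneseries => j _ _; rewrite lee_fin.
apply: nearW => n; rewrite sumEFin lee_fin.
suff H k : \sum_(J <= j < J + k) f j <= C * (rho ^+ J - rho ^+ (J + k)) / (1 - rho).
  have [Jn|nJ] := leqP J n; last first.
    by rewrite big_geq ?(ltnW nJ) // divr_ge0 ?mulr_ge0 ?exprn_ge0 // subr_ge0 ltW.
  rewrite -(subnKC Jn); apply: le_trans (H _) _; rewrite ler_pM2r ?invr_gt0 ?subr_gt0 //.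
  by rewrite ler_wpM2l // lerBlDr lerDl exprn_ge0.
elim: k => [|k IH]; first by rewrite addn0 big_geq // subrr mulr0 mul0r.
rewrite addnS big_nat_recr ?leq_addr //=.
have Hk := HJ (J + k)%N (leq_addr _ _).
apply: le_trans (lerD IH Hk) _; rewrite exprS le_eqVlt; apply/orP; left; apply/eqP.
by field; rewrite subr_eq0 gt_eqF.
Qed.

End Series.

Section LimsupNull.
Context {R : realType}.

(** The Borel-Cantelli argument for Hausdorff measure: the sets of level at least [M] cover [A], and
    their total cost is a tail of a convergent series. *)
Lemma hausdorff_limsup_null (s : R) (A : set R) (U : nat * nat -> set R) : 0 < s ->
  (forall pq, U pq `<=` @Trep R) ->
  (forall M x, A x -> exists j pq, [/\ (M <= j)%N, pq \in Plevel j & U pq x]) ->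
  (\sum_(0 <= j <oo) (\sum_(pq <- Plevel j) diam (U pq) `^ s)%:E < +oo)%E ->
  hausdorff s A = 0%E.
Proof.
move=> s0 UT AU fin; apply: hausdorff_null => // eta eta0.
have f0 j : (0 <= (\sum_(pq <- Plevel j) diam (U pq) `^ s)%:E)%E.
  by rewrite lee_fin sumr_ge0 // => pq _; exact: powR_ge0.
have /fine_cvgP[[N1 _ HN1] /cvgr0Pnorm_lt/(_ _ eta0)[N2 _ HN2]] :=
  nneseries_tail_cvg fin (fun k _ => f0 k).
pose M := maxn N1 N2.
have tail : (\sum_(M <= j <oo) (\sum_(pq <- Plevel j) diam (U pq) `^ s)%:E <= eta%:E)%E.
  rewrite -[leLHS]fineK; last by apply: HN1; rewrite /= leq_maxl.
  rewrite lee_fin; apply: ltW; apply: le_lt_trans (ler_norm _) _.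
  by apply: HN2; rewrite /= leq_maxr.
(* Padding with empty sets, of cost 0, extends the finite levels from [M] on to all pairs of
   indices. *)
pose V (x : nat * nat) := if (M <= x.1)%N && (x.2 < size (Plevel x.1))%N
  then U (nth (0%N, 0%N) (Plevel x.1) x.2) else set0.
have g0 x : (0 <= (diam (V x) `^ s)%:E)%E by rewrite lee_fin powR_ge0.
have diam0 : diam (set0 : set R) `^ s = 0 by rewrite diam_set0 // powR0 // gt_eqF.
have [e e_surj sum_e] := nneseries_pair g0; exists (V \o e); split.
- by move=> i /=; rewrite /V; case: ifP => _; [exact: UT|exact: sub0set].
- move=> x Ax; have [j [pq [Mj pqj Ux]]] := AU M x Ax.
  have [i ei] := e_surj (j, index pq (Plevel j)); exists i => //=.
  by rewrite ei /V /= Mj index_mem pqj nth_index.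
rewrite /cover_sum [leLHS]sum_e; apply: le_trans tail.
rewrite (nneseries_split 0 M) ?add0n => [|j _]; last by apply: nneseries_ge0.
rewrite big_nat_cond big1 ?add0e => [|j /andP[/andP[_ jM] _]]; last first.
  by apply: eseries0 => l _ _; rewrite /V /= leqNgt jM /= diam0.
apply: lee_nneseries => [j _ _|j _]; first exact: nneseries_ge0.
have [Mj|jM] := leqP M j; last first.
  by rewrite eseries0 // => l _ _; rewrite /V /= leqNgt jM /= diam0.
rewrite (eq_eseriesr (g := fun l => if (l < size (Plevel j))%N
    then (diam (U (nth (0%N, 0%N) (Plevel j) l)) `^ s)%:E else 0%E)); last first.
  by move=> l _; rewrite /V /= Mj /=; case: ifP => // _; rewrite diam0.
rewrite nneseries_finite; last by move=> l; rewrite lee_fin powR_ge0.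
by rewrite -sumEFin [leRHS](big_nth (0%N, 0%N)).
Qed.

End LimsupNull.

Section Hit.
Context {R : realType}.

(* The two extreme intervals account for the identification of 0 and 1. *)
Definition near_cantor (m : nat) : set R :=
  (`[0, 3 ^- m]%classic `|` `[1 - 3 ^- m, 1]%classic) `|`
  \big[setU/set0]_(v <- words m) `[wval v - 3 ^- m, wval v + 2 * 3 ^- m]%classic.

Lemma measurable_near_cantor m : measurable (near_cantor m).
Proof.
apply: measurableU; first by apply: measurableU; exact: measurable_itv.
by apply: bigsetU_measurable => v _; exact: measurable_itv.
Qed.

Lemma near_cantorP m (x y : R) : K x -> Trep y -> dT x y < 3 ^- m -> near_cantor m y.
Proof.
move=> [[a xa] _] Ty; have {xa} -> : x = cantor_pt a by [].
have := cantor_pt_bound (R := R) a m; have := cantor_pt_ge0 (R := R) a.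
have := cantor_pt_bound (R := R) a 0; rewrite cpart0 add0r expr0 invr1.
move: Ty; rewrite /Trep /= in_itv /=; set z := cantor_pt a => Ty z1 z0 zm.
have [k ->] := dT_int z y.
rewrite ltr_norml => Hk; have t0 := inv3_gt0 (R := R) m.
have [k0|k0] := eqVneq k 0.
  right; rewrite -bigcup_seq; exists (mkseq a m); first by rewrite /= mem_words size_mkseq.
  have W : cpart a m = wval (mkseq a m) :> R.
    by rewrite -(cpart_prefix (a := a) (v := mkseq a m)) ?size_mkseq.
  by rewrite /= in_itv /= -W; move: Hk; rewrite k0; lra.
left; have [k1|k1] := ltP 0 k.
  left; have : (1 : R) <= k%:~R by rewrite -[1]/(1%:~R) ler_int; lia.
  by rewrite /= in_itv /=; lra.
right; have : k%:~R <= (-1 : R) by rewrite -[-1]/((-1)%:~R) ler_int; lia.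
by rewrite /= in_itv /=; lra.
Qed.

(** Two end intervals of length [3 ^- m] and [2 ^ m] intervals of length [3 * 3 ^- m]. *)
Lemma lebesgue_near_cantor m : (lebesgue_measure (near_cantor m) <= (5 * (2 / 3) ^+ m)%:E)%E.
Proof.
have t0 := inv3_gt0 (R := R) m.
have itv (a b : R) : a <= b -> lebesgue_measure `[a, b]%classic = (b - a)%:E.
  move=> ab; rewrite lebesgue_measure_itv /= lte_fin -EFinB.
  by case: ltP => // ba; congr _%:E; lra.
apply: le_trans (measureU2 _ _ _) _.
- by apply: measurableU; exact: measurable_itv.
- by apply: bigsetU_measurable => v _; exact: measurable_itv.
apply: (@le_trans _ _ ((2 * 3 ^- m)%:E + (3 * (2 / 3) ^+ m)%:E)%E); last first.
  rewrite -EFinD lee_fin expr_div_n.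
  have : 3 ^- m <= 2 ^+ m / 3 ^+ m :> R by rewrite ler_peMl ?(ltW t0) // exprn_ege1 // ler1n.
  by lra.
apply: leeD.
  apply: le_trans (measureU2 _ _ _) _; [exact: measurable_itv|exact: measurable_itv|].
  have H1 := itv 0 (3 ^- m) (ltW t0).
  have H2 : lebesgue_measure `[1 - 3 ^- m : R, 1]%classic = (3 ^- m)%:E.
    by rewrite itv; [congr _%:E|]; lra.
  apply: (@le_trans _ _ ((3 ^- m - 0)%:E + (3 ^- m)%:E)%E).
    by apply: leeD; [rewrite -H1|rewrite -H2].
  by rewrite -EFinD lee_fin; lra.
have H3 (v : seq bool) :
    lebesgue_measure `[wval v - 3 ^- m : R, wval v + 2 * 3 ^- m]%classic = (3 * 3 ^- m)%:E.
  by rewrite itv; [congr _%:E|]; lra.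
apply: le_trans (measure_bigsetU_le _ _ _) _ => [v|]; first exact: measurable_itv.
apply: (@le_trans _ _ (\sum_(v <- words m) (3 * 3 ^- m)%:E)%E).
  by apply: lee_sum => v _; rewrite -(H3 v).
rewrite sumEFin lee_fin big_const_seq count_predT size_words iter_addr_0.
by rewrite -[_ *+ (2 ^ m)%N]mulr_natl natrX expr_div_n; lra.
Qed.

End Hit.

(** Monotone convergence exchanges sum and integral, and an integrable function is finite almost
    everywhere. *)
Lemma ae_nneseries_lty {R : realType} {d : measure_display} {T : measurableType d}
    (P : {measure set T -> \bar R}) (X : nat -> T -> \bar R) :
  (forall j, measurable_fun setT (X j)) -> (forall j w, (0 <= X j w)%E) ->
  (\sum_(0 <= j <oo) \int[P]_w X j w < +oo)%E ->
  {ae P, forall w, (\sum_(0 <= j <oo) X j w < +oo)%E}.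
Proof.
move=> mX X0 fin; have mf : measurable_fun setT (fun w => (\sum_(0 <= j <oo) X j w)%E).
  by apply: ge0_emeasurable_sum => // j w _ _.
have f0 w : (0 <= \sum_(0 <= j <oo) X j w)%E by apply: nneseries_ge0.
have intf : P.-integrable setT (fun w => (\sum_(0 <= j <oo) X j w)%E).
  apply/integrableP; split=> //.
  under eq_integral do rewrite gee0_abs //.
  by rewrite integral_nneseries.
apply: filterS (integrable_ae measurableT intf) => w /(_ I).
by rewrite ge0_fin_numE.
Qed.

Lemma ae_forall_count {R : realType} {d : measure_display} {T : measurableType d}
    (P : {measure set T -> \bar R}) (I : countType) (Q : I -> T -> Prop) :
  (forall i, {ae P, forall w, Q i w}) -> {ae P, forall w, forall i, Q i w}.
Proof.
move=> HQ; have : {ae P, forall w, forall n : nat,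
    if unpickle n is Some i then Q i w else True}.
  by apply: ae_foralln => n; case: unpickle => [i|]; [exact: HQ|exact: aeW].
by apply: filterS => w Hw i; have := Hw (pickle i); rewrite pickleK.
Qed.

Section FirstMoment.
Context {R : realType} {d : measure_display} {Omega : measurableType d}.
Variables (P : probability Omega R) (PK : set (nat * nat)) (Y : nat * nat -> Omega -> R).
Local Notation kappa := (@kappa R).
Hypothesis mY : forall pq, Pcal pq -> measurable_fun setT (Y pq).
Hypothesis sigmaK : @sigmaP R PK = kappa%:E.
Hypothesis nPK_law : forall pq, Pcal pq -> ~ PK pq -> forall B : set R, measurable B ->
  P (Y pq @^-1` B) = lebesgue_measure (B `&` @Trep R).
Variables (mu s : R).
Hypotheses (mu0 : 0 < mu) (s0 : 0 < s) (Hmu : kappa < mu * s)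
  (Hmu2 : 2 + (kappa - 1) * mu < mu * s).

Let m (j : nat) : nat := Num.truncn (mu * j%:R).
Let cost (j : nat) : R := (2 * 3 `^ (- (mu * j%:R))) `^ s.
(** An event containing the one that the ball around [Y pq] meets [K]. Points of [PK] always count;
    the complement of [Trep], where [near_cantorP] says nothing, is null for the others. *)
Let hit (j : nat) (pq : nat * nat) : set Omega :=
  if pq \in Plevel j then
    if `[< PK pq >] then setT else Y pq @^-1` (near_cantor (m j) `|` ~` @Trep R)
  else set0.
Let prob_hit_bound (j : nat) (pq : nat * nat) : R :=
  (`[< PK pq >] : nat)%:R + 5 * (2 / 3) ^+ m j.

Let m_itv j : (m j)%:R <= mu * j%:R < (m j)%:R + 1.
Proof. by rewrite natr1; apply: truncn_itv; rewrite mulr_ge0 // ltW. Qed.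

Let measurable_hit j pq : measurable (hit j pq).
Proof.
rewrite /hit; case: ifP => // /Plevel_Pcal Ppq; case: ifP => // _.
apply: measurable_preY => //; apply: measurableU; first exact: measurable_near_cantor.
by apply: measurableC; exact: measurable_itv.
Qed.

Let prob_hit j pq : pq \in Plevel j -> (P (hit j pq) <= (prob_hit_bound j pq)%:E)%E.
Proof.
move=> pqj; rewrite /hit pqj /prob_hit_bound; have Ppq := Plevel_Pcal pqj.
have b0 : 0 <= 5 * (2 / 3) ^+ m j :> R by rewrite mulr_ge0 // exprn_ge0 // divr_ge0.
case: asboolP => [_|nK]; first by rewrite probability_setT lee_fin lerDl.
have mT : measurable (@Trep R) by exact: measurable_itv.
have mN := measurable_near_cantor (R := R) (m j).
rewrite add0r nPK_law //; last by apply: measurableU => //; exact: measurableC.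
apply: le_trans (lebesgue_near_cantor _); apply: le_measure; rewrite ?inE //.
  by apply: measurableI => //; apply: measurableU => //; exact: measurableC.
by rewrite setIUl setICl setU0; exact: subIsetl.
Qed.

Let X (j : nat) (w : Omega) : \bar R :=
  (\sum_(pq <- Plevel j) (cost j)%:E * (\1_(hit j pq) w)%:E)%E.

Let cost_ge0 j : 0 <= cost j. Proof. exact: powR_ge0. Qed.

Let measurable_term j pq :
  measurable_fun setT (fun w => (cost j)%:E * (\1_(hit j pq) w)%:E)%E.
Proof.
under eq_fun do rewrite -EFinM; apply/measurable_EFinP.
by apply: measurable_funM => //; exact: measurable_indic.
Qed.

Let integral_X j : (\int[P]_w X j w <=
  (cost j * ((countPj PK j)%:R + 9 ^+ j.+1 * (5 * (2 / 3) ^+ m j)))%:E)%E.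
Proof.
rewrite /X ge0_integral_sum //; last by move=> pq w _; rewrite -EFinM lee_fin mulr_ge0.
apply: (@le_trans _ _ (\sum_(pq <- Plevel j) (cost j * prob_hit_bound j pq)%:E)%E).
  rewrite [leLHS]big_seq [leRHS]big_seq; apply: lee_sum => pq pqj.
  rewrite ge0_integralZl; [|exact: measurableT|
    by apply/measurable_EFinP; exact: measurable_indic|by move=> w _; rewrite lee_fin|
    by rewrite lee_fin].
  rewrite integral_indic // setIT EFinM; apply: lee_wpmul2l; first by rewrite lee_fin.
  exact: prob_hit.
rewrite sumEFin lee_fin -mulr_sumr ler_wpM2l // big_split /=.
have -> : \sum_(pq <- Plevel j) (`[< PK pq >] : nat)%:R = (countPj PK j)%:R :> R.
  by rewrite -natr_sum countPjE -sum1_count [in RHS]big_mkcond; congr _%:R.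
rewrite lerD2l // big_const_seq count_predT iter_addr_0 -[_ *+ _]mulr_natl.
rewrite ler_wpM2r ?mulr_ge0 ?exprn_ge0 ?divr_ge0 //.
by rewrite -natrX ler_nat size_Plevel_le.
Qed.

(** Half of the smaller slack in the two conditions on [s]; [3 ^ (- delta)] is the ratio of the
    final geometric series. *)
Let delta : R := Num.min (mu * s - kappa) (mu * s - (2 + (kappa - 1) * mu)) / 2.

Let delta_gt0 : 0 < delta.
Proof. by rewrite divr_gt0 // lt_min !subr_gt0 Hmu Hmu2. Qed.

Let delta_lt : delta < mu * s - kappa /\ delta < mu * s - (2 + (kappa - 1) * mu).
Proof.
have a0 : 0 < mu * s - kappa by rewrite subr_gt0.
have b0 : 0 < mu * s - (2 + (kappa - 1) * mu) by rewrite subr_gt0.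
have Ha : Num.min (mu * s - kappa) (mu * s - (2 + (kappa - 1) * mu)) <= mu * s - kappa.
  by rewrite ge_min lexx.
have Hb : Num.min (mu * s - kappa) (mu * s - (2 + (kappa - 1) * mu)) <=
    mu * s - (2 + (kappa - 1) * mu) by rewrite ge_min lexx orbT.
by rewrite /delta; move: Ha Hb a0 b0; set D := Num.min _ _; lra.
Qed.

Let costE j : cost j = 2 `^ s * 3 `^ (- (mu * s * j%:R)).
Proof.
rewrite /cost powRM ?powR_ge0 // -powRrM; congr (_ * 3 `^ _).
by rewrite mulNr mulrAC.
Qed.

(** Here 135 is [5 * 3 ^ 3]: a factor [3 ^ 2] from [9 ^+ j.+1], and at most 3 from rounding [mu * j]
    down to [m j]. *)
Let ternary_prob_le j :
  9 ^+ j.+1 * (5 * (2 / 3) ^+ m j) <= 135 * 3 `^ ((mu * s - delta) * j%:R) :> R.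
Proof.
have -> : 9 ^+ j.+1 = 3 `^ (2 * j.+1%:R) :> R.
  by rewrite powRrM powR_mulrn ?powR_ge0 // powR_mulrn //; congr (_ ^+ _); rewrite -natrX.
have -> : (2 / 3) ^+ m j = 3 `^ ((kappa - 1) * (m j)%:R) :> R.
  by rewrite powRrM powR_mulrn ?powR_ge0 // powR3D powR_kappa powR_inv1.
have -> : 135 = 5 * 3 `^ 3 :> R by rewrite powR_mulrn // -natrX -natrM.
rewrite mulrCA -[leRHS]mulrA ler_wpM2l // -!powR3D ler_powR3 -natr1.
have [_ Hd] := delta_lt; have /andP[_ mj] := m_itv j.
have : (kappa - 1) * (m j)%:R <= (kappa - 1) * (mu * j%:R - 1).
  by rewrite ler_wnM2l ?subr_le0 ?(ltW (kappa_lt1 (R := R))) //; lra.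
have : (2 + (kappa - 1) * mu) * j%:R <= (mu * s - delta) * j%:R.
  by rewrite ler_wpM2r //; lra.
by have := kappa_gt0 (R := R); lra.
Qed.

Let mean_lty : (\sum_(0 <= j <oo) \int[P]_w X j w < +oo)%E.
Proof.
pose f j := cost j * ((countPj PK j)%:R + 9 ^+ j.+1 * (5 * (2 / 3) ^+ m j)).
apply: (@le_lt_trans _ _ (\sum_(0 <= j <oo) (f j)%:E)%E).
  apply: lee_nneseries => j _; last exact: integral_X.
  move=> _; apply: integral_ge0 => w _; apply: sume_ge0 => pq _.
  by rewrite -EFinM lee_fin mulr_ge0.
(* 136 is 135 plus 1 for the points of [PK], eventually at most [3 ^ ((mu s - delta) j)] in
   number. *)
apply: (@nneseries_lt_geom _ _ (2 `^ s * 136) (3 `^ (- delta))) => [j|||].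
- by apply: mulr_ge0 => //; apply: addr_ge0.
- by apply: mulr_ge0 => //; exact: powR_ge0.
- by rewrite powR_ge0 -[ltRHS](powRr0 3) ltNge ler_powR3 -ltNge oppr_lt0.
have : (@sigmaP R PK < (mu * s - delta)%:E)%E.
  by rewrite sigmaK lte_fin; have [] := delta_lt; lra.
move=> /sigmaP_lt; apply: filterS => j Hj.
have H : (countPj PK j)%:R + 9 ^+ j.+1 * (5 * (2 / 3) ^+ m j) <=
    136 * 3 `^ ((mu * s - delta) * j%:R) :> R.
  by have := ternary_prob_le j; lra.
apply: le_trans (ler_wpM2l (cost_ge0 j) H) _.
rewrite costE -[3 `^ (- delta) ^+ j]powR_mulrn ?powR_ge0 // -powRrM.
rewrite mulrACA ler_wpM2l ?mulr_ge0 ?powR_ge0 // -powR3D ler_powR3.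
by lra.
Qed.

(** Intersecting with [K] makes the set empty, hence of cost 0, unless [hit] occurs. *)
Let ball w pq : set R := [set x | K x /\ dT x (Y pq w) < pq.2%:R `^ (- mu)].

Let diam_ball w j pq : pq \in Plevel j -> diam (ball w pq) `^ s <= cost j * \1_(hit j pq) w.
Proof.
move=> pqj; have [E|/set0P[x [Kx xY]]] := eqVneq (ball w pq) set0.
  by rewrite E diam_set0 // powR0 ?gt_eqF // mulr_ge0.
have := pqj; rewrite mem_Plevel => /and3P[/andP[jq _] _ _].
have r_le : pq.2%:R `^ (- mu) <= 3 `^ (- (mu * j%:R)) :> R.
  rewrite !powRN lef_pV2 ?posrE ?powR_gt0 ?ltr0n ?(leq_trans _ jq) ?expn_gt0 //.
  rewrite mulrC powRrM powR_mulrn // -natrX; apply: ge0_ler_powR; rewrite ?nnegrE ?ler_nat //.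
  exact: ltW.
have hw : hit j pq w.
  rewrite /hit pqj; case: asboolP => // nK.
  have [Ty|] := pselect (Trep (Y pq w)); [left|by right].
  apply: near_cantorP Kx Ty _; apply: lt_le_trans xY _; apply: le_trans r_le _.
  by rewrite inv3E ler_powR3 lerN2; have /andP[] := m_itv j.
rewrite indicE mem_set // mulr1; apply: ge0_ler_powR; rewrite ?nnegrE ?diam_ge0 //.
- exact: ltW.
apply: diam_le => [|y z [_ yY] [_ zY]]; first by rewrite mulr_ge0 ?powR_ge0.
have := dT_triangle (Y pq w) y z; rewrite [dT (Y pq w) z]dTC.
by move: r_le yY zY; lra.
Qed.

Lemma hausdorff_Fset_ae0 :
  {ae P, forall w, hausdorff s (Fset (fun pq => Y pq w) mu `&` @K R) = 0%E}.
Proof.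
have X0 j w : (0 <= X j w)%E.
  by apply: sume_ge0 => pq _; rewrite -EFinM lee_fin mulr_ge0.
have mX j : measurable_fun setT (X j) by exact: emeasurable_sum.
apply: filterS (ae_nneseries_lty mX X0 mean_lty) => w Xw.
apply: (@hausdorff_limsup_null _ _ _ (ball w)) => //.
- by move=> pq x [[_ ?] _].
- move=> M x [[Tx inf] Kx].
  have [|pq [Ppq xY] Mq] := @infinite_set_snd_ge _ (3 ^ M) _ inf.
    by move=> pq [[]].
  have [j pqj] := Pcal_Plevel Ppq; exists j, pq; split => //.
  move: pqj; rewrite mem_Plevel => /and3P[/andP[_ qj] _ _].
  by rewrite -ltnS -(@ltn_exp2l 3) //; exact: leq_ltn_trans qj.
apply: le_lt_trans Xw; apply: lee_nneseries => j _.
  by move=> _; rewrite lee_fin sumr_ge0 // => pq _; exact: powR_ge0.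
rewrite /X -sumEFin [leLHS]big_seq [leRHS]big_seq; apply: lee_sum => pq pqj.
by rewrite -EFinM lee_fin diam_ball.
Qed.

End FirstMoment.

(** * Dimension of the sets of a good realization *)

Section Realization.
Context {R : realType}.
Local Notation kappa := (@kappa R).
Variable y : nat * nat -> R.

Lemma rat_between (a b : R) : a < b -> exists q : rat, a < ratr q < b.
Proof.
by move=> /rat_in_itvoo[q]; rewrite in_itv /=; exists q.
Qed.

Lemma Fset_mubullet (mu xi : R) : 0 <= mu -> Fset y mu xi -> (mu%:E <= mubullet y xi)%E.
Proof. by move=> mu0 Fxi; apply: ereal_sup_ubound; exists mu. Qed.

Lemma Fset_sub_Mbullet (mu mu1 : R) : 0 <= mu1 -> mu <= mu1 -> Fset y mu1 `<=` Mbullet y mu.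
Proof.
move=> mu10 le_mu xi Fxi; split; first by case: Fxi.
by apply: le_trans (Fset_mubullet mu10 Fxi); rewrite lee_fin.
Qed.

Lemma Fset_antitone (mu mu1 : R) : mu <= mu1 -> Fset y mu1 `<=` Fset y mu.
Proof.
move=> le_mu xi [Txi inf]; split => //; apply: sub_infinite_set inf => pq [Ppq dpq].
split => //; apply: lt_le_trans dpq _; apply: ler_powR; last by rewrite lerN2.
by rewrite ler1n; case: Ppq => + _; exact: leq_ltn_trans.
Qed.

Lemma Mbullet_sub_Fset (mu mu1 : R) : mu1 < mu -> Mbullet y mu `<=` Fset y mu1.
Proof.
move=> lt_mu xi [Txi mu_xi]; have : (mu1%:E < mubullet y xi)%E.
  by apply: lt_le_trans mu_xi; rewrite lte_fin.
case/ereal_sup_gt => _ [mu2 [_ Fxi] <-]; rewrite lte_fin => /ltW lt2.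
exact: Fset_antitone lt2 _ Fxi.
Qed.

Definition good_scales (mu s : R) :=
  forall M, exists j n m e, (M <= j)%N /\ good_scale y mu s j n m e.

(** At [s = kappa] the condition [m - 1 < n <= m] gives [n = m]: words are their own extensions, so
    every cylinder of level [m] contains one of the random points. *)
Lemma good_scales_kappa (mu : R) : 0 < mu -> good_scales mu kappa -> @K R `<=` Fset y mu.
Proof.
move=> mu0 good xi Kxi; case: (Kxi) => -[a xa] Txi; split => //.
have {xa} -> : xi = cantor_pt a by [].
apply: infinite_set_snd => M; have [j [n [m [e [Mj [nm]]]]]] := good M.
rewrite divff ?gt_eqF ?kappa_gt0 // mul1r => mn jm He.
have {}mn : n = m.
  apply/eqP; rewrite eqn_leq nm -ltnS -(ltr_nat R) -natr1.
  by move: mn; lra.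
rewrite mn in He; have [|se te [pq [Ppq /andP[q1 q2] yv]]] := He (mkseq a m).
  by rewrite size_mkseq.
have ea : mkseq a m = e (mkseq a m) by rewrite -{1}te -{1}se take_size.
exists pq; last by apply: leq_trans (leq_trans Mj (ltnW (ltn_expl j _))) q1.
split => //; apply: (dT_cantor_pt_lt mu0 jm _ se ea yv).
by rewrite q2 andbT (leq_trans _ q1) ?expn_gt0.
Qed.

Lemma mubullet_ge2 : (forall a : rat, 0 < ratr a :> R -> ratr a < 2 :> R ->
    good_scales (ratr a) kappa) ->
  forall xi, @K R xi -> (2%:E <= mubullet y xi)%E.
Proof.
move=> good xi Kxi; have mub_ge (a : rat) : 0 < ratr a :> R -> ratr a < 2 :> R ->
    ((ratr a)%:E <= mubullet y xi)%E.
  move=> a0 a2; apply: Fset_mubullet; first exact: ltW.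
  by apply: good_scales_kappa Kxi => //; exact: good.
apply/lee_addgt0Pr => e e0.
have [a] : exists a : rat, Num.max 0 (2 - e) < (ratr a : R) < 2.
  by apply: rat_between; rewrite gt_max ltr0n ltrBlDr ltrDl.
rewrite gt_max => /andP[/andP[a0 ae] a2]; apply: le_trans (_ : (ratr a)%:E + e%:E <= _)%E.
  by rewrite -EFinD lee_fin; lra.
by rewrite leeD2r // mub_ge.
Qed.

Lemma hdim_Mbullet_le (mu : R) : 2 <= mu ->
  (forall a b : rat, 0 < ratr a :> R -> 0 < ratr b :> R -> kappa < ratr a * ratr b ->
     2 + (kappa - 1) * ratr a < ratr a * ratr b ->
     hausdorff (ratr b) (Fset y (ratr a) `&` @K R) = 0%E) ->
  (hdim (Mbullet y mu `&` @K R) <= (Num.max (2 / mu + kappa - 1) (kappa / mu))%:E)%E.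
Proof.
move=> mu2 null; have mu0 : 0 < mu by apply: lt_le_trans mu2.
have k0 := kappa_gt0 (R := R); have k1 := kappa_lt1 (R := R).
set f := Num.max _ _; apply/lee_addgt0Pr => e e0.
have [b /andP[fb be]] : exists b : rat, f < (ratr b : R) < f + e.
  by apply: rat_between; rewrite ltrDl.
set s : R := ratr b in fb be.
have /andP[H1 H2] : (2 / mu + kappa - 1 < s) && (kappa / mu < s) by rewrite -gt_max.
have s0 : 0 < s by apply: lt_trans H2; rewrite divr_gt0.
have sk0 : 0 < s + 1 - kappa by lra.
(* The two lower bounds for [a] are the conditions [2 + (kappa - 1) a < a s] and [kappa < a s]
   solved for [a]; both lie below [mu] because [s] exceeds the claimed dimension. *)
have [a /andP[+ amu]] : exists a : rat,
    Num.max (2 / (s + 1 - kappa)) (kappa / s) < (ratr a : R) < mu.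
  apply: rat_between; rewrite gt_max (ltr_pdivrMr _ _ sk0) (ltr_pdivrMr _ _ s0); apply/andP; split.
    by rewrite mulrC -(ltr_pdivrMr _ _ mu0); lra.
  by rewrite mulrC -(ltr_pdivrMr _ _ mu0).
set mu1 : R := ratr a in amu *; rewrite gt_max (ltr_pdivrMr _ _ sk0) (ltr_pdivrMr _ _ s0) => /andP[G1 G2].
have mu10 : 0 < mu1 by rewrite -(pmulr_lgt0 _ s0); exact: lt_trans G2.
apply: (@le_trans _ _ s%:E); last by rewrite -EFinD lee_fin ltW.
apply: ereal_inf_lbound; exists s => //; split => //.
apply/eqP; rewrite eq_le hausdorff_ge0 andbT -(null a b) // -/s -/mu1; last by lra.
apply: hausdorff_le => [|x [_ []]//|x [Mx Kx]]; first exact: ltW.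
by split => //; exact: Mbullet_sub_Fset Mx.
Qed.

Lemma hdim_Mbullet_ge (mu : R) : 2 <= mu ->
  (forall a b : rat, 0 < ratr a :> R -> 0 < ratr b :> R -> ratr b <= kappa ->
     ratr b * ratr a < kappa \/ (ratr b + 1 - kappa) * ratr a < 2 ->
     good_scales (ratr a) (ratr b)) ->
  ((Num.max (2 / mu + kappa - 1) (kappa / mu))%:E <= hdim (Mbullet y mu `&` @K R))%E.
Proof.
move=> mu2 good; have mu0 : 0 < mu by apply: lt_le_trans mu2.
have k0 := kappa_gt0 (R := R); have k1 := kappa_lt1 (R := R).
set f := Num.max _ _; apply: le_ereal_inf_tmp => _ [s [s0 Hs] <-]; rewrite lee_fin leNgt.
apply/negP => sf; have [b /andP[sb bf]] := rat_between sf.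
(* This is where [mu >= 2] enters; it keeps the exponent [s1] below [kappa], as good scales
   require. *)
have fk : f <= kappa.
  rewrite /f ge_max ler_pdivrMr // ler_peMr ?(ltW k0) //; last by lra.
  have : 2 / mu <= 1 by rewrite ler_pdivrMr // mul1r.
  by lra.
set s1 : R := ratr b in sb bf; have s10 : 0 < s1 by exact: lt_trans sb.
(* Whichever term of the maximum exceeds [s1] leaves room for a rational [a > mu] and selects which
   kind of points to use. *)
have [a [amu Ha]] : exists a : rat, mu < ratr a :> R /\
    (s1 * ratr a < kappa \/ (s1 + 1 - kappa) * ratr a < 2).
  move: bf; rewrite /f lt_max => /orP[H|H].
    have sk0 : 0 < s1 + 1 - kappa by lra.
    have [a /andP[amu Ha]] : exists a : rat, mu < (ratr a : R) < 2 / (s1 + 1 - kappa).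
      by apply: rat_between; rewrite ltr_pdivlMr // mulrC -ltr_pdivlMr //; lra.
    by exists a; split => //; right; rewrite mulrC -ltr_pdivlMr.
  have [a /andP[amu Ha]] : exists a : rat, mu < (ratr a : R) < kappa / s1.
    by apply: rat_between; rewrite ltr_pdivlMr // mulrC -ltr_pdivlMr.
  by exists a; split => //; left; rewrite mulrC -ltr_pdivlMr.
have a0 : 0 < ratr a :> R by exact: lt_trans amu.
have s1k : s1 <= kappa by apply: ltW; exact: lt_le_trans fk.
apply: (hausdorff_Fset_neq0 a0 s0 sb s1k (good a b a0 s10 s1k Ha)).
apply/eqP; rewrite eq_le hausdorff_ge0 andbT -Hs.
apply: hausdorff_le => [|x [_ []]//|x [Fx Kx]]; first exact: ltW.
by split => //; apply: Fset_sub_Mbullet Fx; exact: ltW.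
Qed.

End Realization.

Unset Implicit Arguments.

Theorem theorem2p4 (R : realType) (d : measure_display) (Omega : measurableType d)
  (P : probability Omega R) (PK : set (nat * nat)) (Y : nat * nat -> Omega -> R) :
  PK `<=` Pcal ->
  @sigmaP R PK = (@kappa R)%:E ->
  (forall pq, Pcal pq -> measurable_fun setT (Y pq)) ->
  (* distribution of Y_{p,q}: normalized kappa-dim Hausdorff measure on K *)
  (forall pq, PK pq -> forall B : set R, measurable B ->
     P (Y pq @^-1` B) =
     (hausdorff (@kappa R) (B `&` @K R) * ((fine (hausdorff (@kappa R) (@K R)))^-1)%:E)%E) ->
  (* distribution of Y_{p,q}: Lebesgue measure on T *)
  (forall pq, Pcal pq -> ~ PK pq -> forall B : set R, measurable B ->
     P (Y pq @^-1` B) = lebesgue_measure (B `&` @Trep R)) ->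
  (* mutual independence of the family (Y_{p,q})_{(p,q) in P} *)
  (forall (s : seq (nat * nat)) (B : nat * nat -> set R),
     uniq s -> (forall pq, pq \in s -> Pcal pq) ->
     (forall pq, measurable (B pq)) ->
     fine (P (\bigcap_(pq in [set pq | pq \in s]) (Y pq @^-1` B pq))) =
     \prod_(pq <- s) fine (P (Y pq @^-1` B pq))) ->
  {ae P, forall w : Omega,
     (forall xi, @K R xi -> (2%:E <= mubullet (fun pq => Y pq w) xi)%E) /\
     (forall mu : R, 2 <= mu ->
        hdim (Mbullet (fun pq => Y pq w) mu `&` @K R) =
        (Num.max (2 / mu + @kappa R - 1) (@kappa R / mu))%:E)}.
Proof.
move=> _ sigmaK mY PK_law nPK_law indep.
have k0 := kappa_gt0 (R := R); have k1 := kappa_lt1 (R := R).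
have ae_part1 : {ae P, forall w, forall a : rat, 0 < ratr a :> R -> ratr a < 2 :> R ->
    good_scales (fun pq => Y pq w) (ratr a) (@kappa R)}.
  apply: ae_forall_count => a.
  have [a0|na0] := pselect (0 < ratr a :> R); last by apply: aeW => w /na0.
  have [a2|na2] := pselect (ratr a < 2 :> R); last by apply: aeW => w _ /na2.
  (* With [s = kappa] the condition on Lebesgue points reduces to [ratr a < 2]. *)
  apply: filterS (good_scales_nPK mY sigmaK nPK_law indep a0 k0 (lexx _) _) => [w Hw _ _ //|].
  by rewrite addrAC subrr add0r mul1r.
(* Pairs of rationals keep the exceptional null sets countable in number, so that one event of
   probability one serves every real [mu]. *)
have ae_lower : {ae P, forall w, forall ab : rat * rat, 0 < ratr ab.1 :> R ->
    0 < ratr ab.2 :> R -> ratr ab.2 <= @kappa R ->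
    ratr ab.2 * ratr ab.1 < @kappa R \/ (ratr ab.2 + 1 - @kappa R) * ratr ab.1 < 2 ->
    good_scales (fun pq => Y pq w) (ratr ab.1) (ratr ab.2)}.
  apply: ae_forall_count => -[a b] /=.
  have [a0|na0] := pselect (0 < ratr a :> R); last by apply: aeW => w /na0.
  have [b0|nb0] := pselect (0 < ratr b :> R); last by apply: aeW => w _ /nb0.
  have [bk|nbk] := pselect (ratr b <= @kappa R); last by apply: aeW => w _ _ /nbk.
  have [H|nH] := pselect (ratr b * ratr a < @kappa R).
    by apply: filterS (good_scales_PK mY sigmaK PK_law indep a0 b0 bk H) => w Hw _ _ _ _.
  have [H|nH'] := pselect ((ratr b + 1 - @kappa R) * ratr a < 2).
    by apply: filterS (good_scales_nPK mY sigmaK nPK_law indep a0 b0 bk H) => w Hw _ _ _ _.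
  by apply: aeW => w _ _ _ [].
have ae_upper : {ae P, forall w, forall ab : rat * rat, 0 < ratr ab.1 :> R ->
    0 < ratr ab.2 :> R -> @kappa R < ratr ab.1 * ratr ab.2 ->
    2 + (@kappa R - 1) * ratr ab.1 < ratr ab.1 * ratr ab.2 ->
    hausdorff (ratr ab.2) (Fset (fun pq => Y pq w) (ratr ab.1) `&` @K R) = 0%E}.
  apply: ae_forall_count => -[a b] /=.
  have [a0|na0] := pselect (0 < ratr a :> R); last by apply: aeW => w /na0.
  have [b0|nb0] := pselect (0 < ratr b :> R); last by apply: aeW => w _ /nb0.
  have [H1|nH1] := pselect (@kappa R < ratr a * ratr b); last by apply: aeW => w _ _ /nH1.
  have [H2|nH2] := pselect (2 + (@kappa R - 1) * ratr a < ratr a * ratr b); last first.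
    by apply: aeW => w _ _ _ /nH2.
  by apply: filterS (hausdorff_Fset_ae0 mY sigmaK nPK_law a0 b0 H1 H2) => w Hw _ _ _ _.
apply: filterS3 ae_part1 ae_lower ae_upper => w part1 lower upper; split.
  exact: mubullet_ge2.
move=> mu mu2; apply/eqP; rewrite eq_le; apply/andP; split.
  by apply: hdim_Mbullet_le => // a b; exact: (upper (a, b)).
by apply: hdim_Mbullet_ge => // a b; exact: (lower (a, b)).
Qed.
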